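(* Let $N\ge1$ be an integer. Assume \[ \mathcal V_N(a_n^{-1}:n\ge0)+\mathcal V_N(a_n^{-1}b_n:n\ge0)+\mathcal V_N(a_n^{-1}a_{n-1}^*:n\ge1)<\infty , \] and let (a) $\lim_{n\to\infty}\|a_n^{-1}-T_n\|=0$, (b) $\lim_{n\to\infty}\|a_n^{-1}b_n-Q_n\|=0$, (c) $\lim_{n\to\infty}\|a_n^{-1}a_{n-1}^*-R_n\|=0$, (d) $\lim_{n\to\infty}\left\|\frac{a_n}{\|a_n\|}-C_n\right\|=0$ for $N$-periodic sequences $(T_n:n\ge0)$, $(Q_n:n\ge0)$, $(R_n:n\ge0)$, $(C_n:n\ge0)$ of bounded operators on $\mathcal H$, with every $C_n$ invertible. Suppose that the set $\Lambda$ of those $\lambda\in\mathbb R$ for which \[ \mathcal F(\lambda)=\mathrm{Re}\left[\begin{pmatrix}0&-C_{N-1}\\ C_{N-1}^*&0\end{pmatrix}\prod_{i=0}^{N-1}\begin{pmatrix}0&\mathrm{Id}\\ -R_i&\lambda T_i-Q_i\end{pmatrix}\right] \] is a strictly positive or a strictly negative operator on $\mathcal H\oplus\mathcal H$ is non-empty. If the Carleman condition \[ \sum_{n=0}^\infty\frac1{\|a_n\|}=\infty \] is not satisfied, then for every compact set $K\subset\mathbb C$ there are positive constants $c_1,c_2$ such that for every generalised eigenvector $u$ associated with $z\in K$ and every $n\ge1$ \[ c_1(\|u_0\|^2+\|u_1\|^2)\le\|a_n\|(\|u_{n-1}\|^2+\|u_n\|^2)\le c_2(\|u_0\|^2+\|u_1\|^2).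 \] Consequently, for every $z\in\mathbb C$ \[ \ker[A^*-z\,\mathrm{Id}]\simeq\mathcal H \] (the completely indeterminate case). In particular, the symmetric operator $A$ is not self-adjoint but it has self-adjoint extensions.
   Context: Let $\mathcal H\neq\{0\}$ be a complex Hilbert space, and let $(a_n:n\ge 0)$, $(b_n:n\ge 0)$ be sequences of bounded linear operators on $\mathcal H$ such that every $a_n$ has a bounded inverse and every $b_n$ is self-adjoint. $\|\cdot\|$ on operators is the operator norm. The formal matrix $\mathcal A$ acts on any sequence $u=(u_n:n\ge0)$ in $\mathcal H$ by $(\mathcal A u)_0=b_0u_0+a_0u_1$ and $(\mathcal A u)_n=a_{n-1}^*u_{n-1}+b_nu_n+a_nu_{n+1}$ for $n\ge1$. The operator $A$ is the closure in $\ell^2(\mathbb N;\mathcal H)$ ($\mathbb N=\{0,1,2,\dots\}$) of the restriction of $\mathcal A$ to the finitely supported sequences; $A^*$ is its adjoint. The symbol $\simeq$ denotes linear homeomorphism (isomorphism of Hilbert spaces). For $z\in\mathbb C$, a generalised eigenvector associated with $z$ is a non-zero sequence $u=(u_n:n\ge0)$ in $\mathcal H$ with $a_{n-1}^*u_{n-1}+b_nu_n+a_nu_{n+1}=zu_n$ for all $n\ge1$. The total $N$-variation of a sequence $(x_n:n\ge n_0)$ in a normed space is $\mathcal V_N(x_n:n\ge n_0)=\sum_{n=n_0}^\infty\|x_{n+N}-x_n\|$. Products of operators are ordered with larger indices to the left: $\prod_{k=n_0}^{n_1}X_k=X_{n_1}X_{n_1-1}\cdots X_{n_0}$. For a bounded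 operator $X$, $\mathrm{Re}[X]=\frac12(X+X^* )$. A bounded self-adjoint operator $X$ is strictly positive if $X\ge c\,\mathrm{Id}$ for some $c>0$, and strictly negative if $-X$ is strictly positive. *)

(* Defs.v *)
From HB Require Import structures.
From mathcomp Require Import all_boot all_order all_algebra.
From mathcomp Require Import all_classical all_reals all_analysis.
From mathcomp Require Import complex ring.

Set Implicit Arguments.
Unset Strict Implicit.
Unset Printing Implicit Defensive.

Import Order.TTheory GRing.Theory Num.Theory numFieldNormedType.Exports.
Local Open Scope classical_set_scope.
Local Open Scope ring_scope.

Section DotNorm.
Variables (C : numClosedFieldType) (V : lmodType C).
Variable dot : {dot V for Num.conj}.

Lemma dot_CauchySchwarz x y :
  `|dot x y| <= sqrtC (dot x x) * sqrtC (dot y y).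
Proof.
rewrite -(@ler_pXn2r _ 2) ?nnegrE ?mulr_ge0 ?sqrt_dnorm_ge0//.
rewrite exprMn !sqrtCK.
have [->|y0] := eqVneq y 0; first by rewrite !linear0r normr0 expr0n.
have yy : 0 < dot y y by rewrite dnorm_gt0.
have yyc : (dot y y)^* = dot y y by rewrite geC0_conj// ltW.
pose t := dot x y / dot y y.
have := dnorm_ge0 dot (x - t *: y).
have -> : dot (x - t *: y) (x - t *: y) =
          dot x x - `|dot x y| ^+ 2 / dot y y.
  rewrite dnormB dnormZ linearZr_LR/=.
  have -> : t^* * dot x y = `|dot x y| ^+ 2 / dot y y.
    by rewrite /t rmorphM/= fmorphV/= yyc mulrAC [_^* * _]mulrC -normCK.
  rewrite {1}/t normrM normfV (ger0_norm (ltW yy)).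
  rewrite [X in _ - (_ + X)]rmorphM fmorphV/= yyc.
  rewrite (geC0_conj (exprn_ge0 2 (normr_ge0 _))) exprMn.
  rewrite -mulrA exprVn [X in _ * X](_ : _ = (dot y y)^-1); last first.
    by rewrite expr2 invfM -mulrA mulVf ?mulr1// gt_eqF.
  by rewrite opprD addrA addrK.
by rewrite subr_ge0 ler_pdivrMr.
Qed.

Lemma dot_ler_normD x y :
  sqrtC (dot (x + y) (x + y)) <= sqrtC (dot x x) + sqrtC (dot y y).
Proof.
have nx := sqrt_dnorm_ge0 dot x; have ny := sqrt_dnorm_ge0 dot y.
rewrite -(@ler_pXn2r _ 2) ?nnegrE ?addr_ge0 ?sqrt_dnorm_ge0//.
rewrite sqrrD !sqrtCK dnormD/= addrAC lerD2r lerD2l.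
have dr : dot x y + (dot x y)^* \is Num.real.
  by rewrite CrealE rmorphD/= conjCK addrC.
apply: (le_trans (real_ler_norm dr)); apply: (le_trans (ler_normD _ _)).
by rewrite norm_conjC -mulr2n lerMn2r dot_CauchySchwarz orbT.
Qed.

End DotNorm.

HB.mixin Record NormedModule_isPreHilbert (R : realType) V
    & NormedModule R[i] V := {
  dotp : {dot V for Num.conj} ;
  dotp_norm : forall x : V, dotp x x = `|x| ^+ 2
}.

#[short(type="preHilbertType")]
HB.structure Definition PreHilbert (R : realType) :=
  {V of NormedModule R[i] V & NormedModule_isPreHilbert R V}.

#[short(type="hilbertType")]
HB.structure Definition Hilbert (R : realType) :=
  {V of CompleteNormedModule R[i] V & NormedModule_isPreHilbert R V}.

HB.factory Record Lmodule_isPreHilbert (R : realType) V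
    & GRing.Lmodule R[i] V := {
  dot : {dot V for Num.conj}
}.

HB.builders Context (R : realType) V & Lmodule_isPreHilbert R V.

Let normrZ (l : R[i]) (x : V) :
  sqrtC (dot (l *: x) (l *: x)) = `|l| * sqrtC (dot x x).
Proof. by rewrite dnormZ rootCMl ?exprn_ge0// exprCK. Qed.

Let normr0_eq0 (x : V) : sqrtC (dot x x) = 0 -> x = 0.
Proof. by move/eqP; rewrite sqrt_dnorm_eq0 => /eqP. Qed.

HB.instance Definition _ :=
  Lmodule_isNormed.Build R[i] V (dot_ler_normD dot) normrZ normr0_eq0.

Let dot_norm (x : V) : dot x x = `|x| ^+ 2.
Proof. by rewrite sqrtCK. Qed.

HB.instance Definition _ := NormedModule_isPreHilbert.Build R V dot_norm.

HB.end.

Section DirectSum.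
Variables (R : realType) (H : preHilbertType R).

(* An alias of [H * H], whose canonical norm is the maximum of the norms of the
   components and does not come from an inner product. *)
Definition dsum : Type := (H * H)%type.
HB.instance Definition _ := GRing.Lmodule.on dsum.

Definition dsum_dot (u v : dsum) : R[i] := dotp u.1 v.1 + dotp u.2 v.2.

Let dsum_dot_bilinear :
  bilinear_for (GRing.Scale.Law.clone _ _ *%R _)
    (GRing.Scale.Law.clone _ _ (Num.conj \; *%R) _) dsum_dot.
Proof.
split=> [w|w] a u v; rewrite /dsum_dot/=.
  by rewrite !linearDl !linearZl_LR/= mulrDr addrACA.
by rewrite !linearDr !linearZr_LR/= addrACA.
Qed.

HB.instance Definition _ :=
  bilinear_isBilinear.Build R[i] _ _ _ _ _ dsum_dot dsum_dot_bilinear.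

Let dsum_dot_hermitian u v : dsum_dot u v = (-1) ^+ false * (dsum_dot v u)^*.
Proof.
rewrite expr0 mul1r /dsum_dot rmorphD/=.
by congr (_ + _); rewrite hermC expr0 mul1r.
Qed.

HB.instance Definition _ :=
  isHermitianSesquilinear.Build R[i] dsum false Num.conj dsum_dot
    dsum_dot_hermitian.

Let dsum_dot_gt0 u : u != 0 -> 0 < dsum_dot u u.
Proof.
case: u => x y xy0; rewrite /dsum_dot/= lt_def addr_ge0 ?dnorm_ge0// andbT.
rewrite paddr_eq0 ?dnorm_ge0// !dnorm_eq0; apply: contra xy0.
by move=> /andP[/eqP-> /eqP->].
Qed.

HB.instance Definition _ :=
  isDotProduct.Build R[i] dsum dsum_dot dsum_dot_gt0.

HB.instance Definition _ := Lmodule_isPreHilbert.Build R dsum dsum_dot.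

End DirectSum.

Section RealNorm.
Variables (R : realType) (V : normedModType R[i]).
Implicit Types x y : V.

(* The norm of a normed module over [R[i]] takes values in [R[i]]. *)
Definition rnorm x : R := complex.Re `|x|.

Lemma rnormE x : (rnorm x)%:C%C = `|x|.
Proof. by rewrite RRe_real ?ger0_real. Qed.

Lemma rnorm_ge0 x : 0 <= rnorm x.
Proof. by rewrite -lecR rnormE normr_ge0. Qed.

Lemma rnorm0_eq0 x : rnorm x = 0 -> x = 0.
Proof. by move=> x0; apply/eqP; rewrite -normr_eq0 -rnormE x0. Qed.

Lemma ler_rnormD x y : rnorm (x + y) <= rnorm x + rnorm y.
Proof. by rewrite -lecR rmorphD/= !rnormE ler_normD. Qed.

Lemma rnormZ (a : R[i]) x : rnorm (a *: x) = complex.Re `|a| * rnorm x.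
Proof.
apply: (@complexI R).
by rewrite rmorphM/= !rnormE normrZ.
Qed.

End RealNorm.

Section Csum.
Variable R : realType.
Implicit Types z w : nat -> R[i].

Definition csummable z := cvgn (series (fun n => complex.Re (z n))) /\
                   cvgn (series (fun n => complex.Im (z n))).

(* [R[i]] has no canonical complete structure, so the sum of a series is taken
   componentwise. *)
Definition csum z : R[i] :=
  Complex (limn (series (fun n => complex.Re (z n))))
          (limn (series (fun n => complex.Im (z n)))).

Lemma csummable_le z (b : nat -> R) :
  (forall n, complex.Re `|z n| <= b n) -> cvgn (series b) -> csummable z.
Proof.
move=> zb cb; have b0 n : 0 <= b n.
  by apply: le_trans (zb n); rewrite -lecR RRe_real ?ger0_real ?normr_ge0.
split; apply: (@normed_cvg _ R^o); apply: series_le_cvg cb => n //=;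
    apply: le_trans (zb n); rewrite -lecR RRe_real ?ger0_real//.
- exact: normc_ge_Re.
- have := normc_ge_Re (z n * 'i%C); rewrite ReiNIm normrN normrM.
  by rewrite (_ : `|'i%C : R[i]| = 1) ?mulr1// normc_def/= expr0n add0r expr1n sqrtr1.
Qed.

Lemma csum_linear a z w : csummable z -> csummable w ->
  csum (fun n => a * z n + w n) = a * csum z + csum w.
Proof.
case: a => a b [z1 z2] [w1 w2].
rewrite /csum; apply/eqP; rewrite eq_complex/=; apply/andP; split; apply/eqP.
- rewrite (_ : (fun n => _) = a *: (fun n => complex.Re (z n))
    - b *: (fun n => complex.Im (z n)) + (fun n => complex.Re (w n))).
    rewrite lim_seriesD//; last first.
      by apply: is_cvg_seriesB; apply: is_cvg_seriesZ.
    rewrite lim_seriesB; try exact: is_cvg_seriesZ.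
    by rewrite !lim_seriesZ.
  by apply/funext => n; rewrite !fctE; case: (z n) (w n) => [? ?] [? ?].
- rewrite (_ : (fun n => _) = a *: (fun n => complex.Im (z n))
    + b *: (fun n => complex.Re (z n)) + (fun n => complex.Im (w n))).
    rewrite lim_seriesD//; last first.
      by apply: is_cvg_seriesD; apply: is_cvg_seriesZ.
    rewrite lim_seriesD; try exact: is_cvg_seriesZ.
    by rewrite !lim_seriesZ.
  by apply/funext => n; rewrite !fctE; case: (z n) (w n) => [? ?] [? ?].
Qed.

Lemma csum_conj z : csummable z -> csum (fun n => (z n)^*) = (csum z)^*.
Proof.
move=> [z1 z2]; rewrite /csum; apply/eqP; rewrite eq_complex/=.
apply/andP; split; apply/eqP.
  by congr (limn (series _)); apply/funext => n; case: (z n).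
rewrite -lim_seriesN//; congr (limn (series _)).
by apply/funext => n; rewrite fctE; case: (z n).
Qed.

End Csum.

Section Ell2.
Variables (R : realType) (H : preHilbertType R).

Definition ell2_pred : {pred nat -> H} :=
  [pred u | `[< cvgn (series (fun n => rnorm (u n) ^+ 2)) >]].

Let ell2P (u : nat -> H) :
  reflect (cvgn (series (fun n => rnorm (u n) ^+ 2))) (u \in ell2_pred).
Proof. exact: asboolP. Qed.

Let ell2_closed : submod_closed ell2_pred.
Proof.
split.
  apply/ell2P; rewrite (_ : (fun n => _) = fun=> 0); last first.
    by apply/funext => n; rewrite /rnorm normr0 expr0n.
  rewrite (_ : series _ = fun=> 0); first exact: is_cvg_cst.
  by apply/funext => n; rewrite /series/= big1.
move=> a u v /ell2P cu /ell2P cv; apply/ell2P.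
set A := complex.Re `|a|.
have cb : cvgn (series ((A ^+ 2 *+ 2) *: (fun n => rnorm (u n) ^+ 2)
    + (2 : R) *: (fun n => rnorm (v n) ^+ 2))).
  by apply: is_cvg_seriesD; apply: is_cvg_seriesZ.
apply: series_le_cvg cb => n; rewrite ?fctE/=.
- by rewrite sqr_ge0.
- by rewrite addr_ge0// mulr_ge0 ?sqr_ge0// mulrn_wge0 ?sqr_ge0.
- have : rnorm (a *: u n + v n) <= A * rnorm (u n) + rnorm (v n).
    by rewrite -rnormZ ler_rnormD.
  have := rnorm_ge0 (a *: u n + v n); move: (rnorm (a *: u n + v n)) => t.
  rewrite /GRing.scale/=; move: (rnorm (u n)) (rnorm (v n)) => p q t0 tpq.
  apply: (@le_trans _ _ ((A * p + q) ^+ 2)).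
    by rewrite lerXn2r ?nnegrE// (le_trans t0).
  rewrite -subr_ge0 (_ : _ - _ = (A * p - q) ^+ 2) ?sqr_ge0//.
  by rewrite mulr2n; ring.
Qed.

HB.instance Definition _ :=
  GRing.isSubmodClosed.Build R[i] (nat -> H) ell2_pred ell2_closed.

Record ell2 : Type := Ell2 { ell2_val :> nat -> H ; _ : ell2_val \in ell2_pred }.

HB.instance Definition _ := [isSub for ell2_val].
HB.instance Definition _ := [Choice of ell2 by <:].
HB.instance Definition _ := [SubChoice_isSubLmodule of ell2 by <:].

Definition ell2_dot (u v : ell2) : R[i] := csum (fun n => dotp (u n) (v n)).

Let ell2_sum (u : ell2) : cvgn (series (fun n => rnorm (u n) ^+ 2)).
Proof. exact/ell2P/(valP u). Qed.

Let ell2_csum (u v : ell2) : csummable (fun n => dotp (u n) (v n)).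
Proof.
apply: (csummable_le (b := (fun n => rnorm (u n) ^+ 2)
                         + (fun n => rnorm (v n) ^+ 2))); last first.
  by apply: is_cvg_seriesD; exact: ell2_sum.
move=> n; rewrite fctE.
have uv : complex.Re `|dotp (u n) (v n)| <= rnorm (u n) * rnorm (v n).
  rewrite -lecR RRe_real ?ger0_real ?normr_ge0// rmorphM/= !rnormE.
  by rewrite (le_trans (dot_CauchySchwarz _ _ _))// !dotp_norm !exprCK.
apply: (le_trans uv).
have := rnorm_ge0 (u n); have := rnorm_ge0 (v n).
move: (rnorm (u n)) (rnorm (v n)) => p q q0 p0.
rewrite -subr_ge0 (_ : _ - _ = (p - q) ^+ 2 + p * q); last by ring.
by rewrite addr_ge0 ?sqr_ge0 ?mulr_ge0.
Qed.

Let ell2_dot_hermitian u v : ell2_dot u v = (-1) ^+ false * (ell2_dot v u)^*.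
Proof.
rewrite expr0 mul1r /ell2_dot -csum_conj//; congr csum; apply/funext => n.
by rewrite hermC expr0 mul1r.
Qed.

Let ell2_dot_linearl w a u v :
  ell2_dot (a *: u + v) w = a * ell2_dot u w + ell2_dot v w.
Proof.
rewrite /ell2_dot -csum_linear//; congr csum; apply/funext => n.
by rewrite !linearDl !linearZl_LR.
Qed.

Let ell2_dot_bilinear :
  bilinear_for (GRing.Scale.Law.clone _ _ *%R _)
    (GRing.Scale.Law.clone _ _ (Num.conj \; *%R) _) ell2_dot.
Proof.
split=> w a u v /=; first exact: ell2_dot_linearl.
rewrite ell2_dot_hermitian ell2_dot_linearl expr0 mul1r.
rewrite [ell2_dot w u]ell2_dot_hermitian [ell2_dot w v]ell2_dot_hermitian.
by rewrite expr0 !mul1r rmorphD rmorphM.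
Qed.

HB.instance Definition _ :=
  bilinear_isBilinear.Build R[i] _ _ _ _ _ ell2_dot ell2_dot_bilinear.

HB.instance Definition _ :=
  isHermitianSesquilinear.Build R[i] ell2 false Num.conj ell2_dot
    ell2_dot_hermitian.

Let ell2_dot_gt0 u : u != 0 -> 0 < ell2_dot u u.
Proof.
move=> u0; have [n un0] : exists n, u n != 0.
  apply: contrapT => /forallNP un; move/eqP: u0; apply; apply: val_inj.
  by apply/funext => n; apply/eqP; apply: contrapT => /negP; exact: un.
have unE k : dotp (u k) (u k) = (rnorm (u k) ^+ 2)%:C%C.
  by rewrite dotp_norm rmorphXn/= rnormE.
rewrite /ell2_dot /csum ltcE/=.
rewrite (_ : (fun k => complex.Im _) = fun=> 0); last first.
  by apply/funext => k; rewrite unE.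
rewrite (_ : series (fun=> 0) = fun=> 0); last first.
  by apply/funext => k; rewrite /series/= big1.
rewrite lim_cst// eqxx/=.
rewrite (_ : (fun k => complex.Re _) = fun k => rnorm (u k) ^+ 2); last first.
  by apply/funext => k; rewrite unE.
have nd : nondecreasing_seq (series (fun k => rnorm (u k) ^+ 2)).
  by apply/nondecreasing_series => k _ _; rewrite sqr_ge0.
apply: lt_le_trans (nondecreasing_cvgn_le nd _ n.+1); last exact: ell2_sum.
rewrite /series/= big_nat_recr//= ltr_wpDl ?sumr_ge0//.
  by move=> k _; rewrite sqr_ge0.
rewrite exprn_gt0// lt_def rnorm_ge0 andbT.
by apply: contra un0 => /eqP/rnorm0_eq0->.
Qed.

HB.instance Definition _ :=
  isDotProduct.Build R[i] ell2 ell2_dot ell2_dot_gt0.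

HB.instance Definition _ := Lmodule_isPreHilbert.Build R ell2 ell2_dot.

End Ell2.

Section BoundedOperators.
Variable R : realType.

Definition bounded_op (V : normedModType R[i]) (X : V -> V) : Prop :=
  linear X /\ exists M : R, forall x, rnorm (X x) <= M * rnorm x.

Definition opnorm (V : normedModType R[i]) (X : V -> V) : R :=
  sup [set rnorm (X x) | x in [set x : V | rnorm x <= 1]].

Definition boundedly_invertible (V : normedModType R[i]) (X : V -> V) : Prop :=
  exists Y : V -> V, [/\ bounded_op Y, cancel X Y & cancel Y X].

Definition invop (V : normedModType R[i]) (X : V -> V) : V -> V :=
  'pinv_(fun=> 0) [set: V] X.

(* [adj X y] is the Riesz representative of [x |-> dotp (X x) y]; it exists and
   is unique when [X] is bounded and [V] is complete. *)
Definition adj (V : preHilbertType R) (X : V -> V) (y : V) : V :=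
  xget 0 [set w | forall x, dotp (X x) y = dotp x w].

Definition self_adjoint_op (V : preHilbertType R) (X : V -> V) : Prop :=
  adj X = X.

Definition re_op (V : preHilbertType R) (X : V -> V) : V -> V :=
  2^-1 *: (X + adj X).

(* The order of [R[i]] makes each inequality also assert that
   [dotp (X x) x] is real. *)
Definition strictly_positive (V : preHilbertType R) (X : V -> V) : Prop :=
  exists2 c : R, 0 < c & forall x, c%:C%C * dotp x x <= dotp (X x) x.

Definition strictly_negative (V : preHilbertType R) (X : V -> V) : Prop :=
  strictly_positive (- X).

Definition op_variation (V : normedModType R[i]) (N n0 : nat)
    (x : nat -> V -> V) : \bar R :=
  (\sum_(n0 <= n <oo) (opnorm (x (n + N)%N - x n))%:E)%E.

(* [op_prod X n] is [X n.-1 \o ... \o X 0]. *)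
Fixpoint op_prod (V : Type) (X : nat -> V -> V) (n : nat) : V -> V :=
  if n is m.+1 then X m \o op_prod X m else idfun.

Definition op_block (H : preHilbertType R) (X11 X12 X21 X22 : H -> H) :
    dsum H -> dsum H :=
  fun v => (X11 v.1 + X12 v.2, X21 v.1 + X22 v.2).

End BoundedOperators.

(* An unbounded operator on [V] is represented by its graph. *)
Section UnboundedOperators.
Variables (R : realType) (V : preHilbertType R).
Implicit Types (G : set (V * V)) (z : R[i]).

Definition linear_graph G : Prop :=
  [/\ G (0, 0),
      forall a p q, G p -> G q -> G (a *: p + q) &
      forall w, G (0, w) -> w = 0].

Definition densely_defined G : Prop := dense (fst @` G).

Definition adj_graph G : set (V * V) :=
  [set p | forall q, G q -> dotp q.2 p.1 = dotp q.1 p.2].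

Definition symmetric_graph G : Prop :=
  [/\ linear_graph G, densely_defined G & G `<=` adj_graph G].

Definition self_adjoint_graph G : Prop :=
  [/\ linear_graph G, densely_defined G & adj_graph G = G].

Definition ker_sub G z : set V := [set v | G (v, z *: v)].

Definition linearly_homeomorphic (K : set V) (W : normedModType R[i]) : Prop :=
  exists (f : W -> V) (g : V -> W),
    [/\ linear f, continuous f, range f = K, cancel f g &
        {within K, continuous g}].

End UnboundedOperators.

Section BlockJacobi.
Variables (R : realType) (H : preHilbertType R).
Variables a b : nat -> H -> H.

Definition jacobi (u : nat -> H) (n : nat) : H :=
  if n is m.+1 then adj (a m) (u m) + b n (u n) + a n (u n.+1)
  else b 0%N (u 0%N) + a 0%N (u 1%N).

Definition jacobi_graph : set (ell2 H * ell2 H) :=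
  closure [set p : ell2 H * ell2 H |
    (exists m, forall n, (m <= n)%N -> p.1 n = 0) /\
    forall n, p.2 n = jacobi p.1 n].

Definition generalised_eigenvector (z : R[i]) (u : nat -> H) : Prop :=
  (exists n, u n != 0) /\ forall n, (1 <= n)%N -> jacobi u n = z *: u n.

Definition carleman : Prop :=
  (\sum_(0 <= n <oo) ((opnorm (a n))^-1)%:E = +oo :> \bar R)%E.

End BlockJacobi.

Definition calF (R : realType) (H : preHilbertType R) (N : nat)
    (T Q Rl C : nat -> H -> H) (lambda : R) : dsum H -> dsum H :=
  re_op (op_block 0 (- C N.-1) (adj (C N.-1)) 0 \o
         op_prod (fun i =>
           op_block 0 idfun (- Rl i) (lambda%:C%C *: T i - Q i)) N).

Definition Lambda (R : realType) (H : preHilbertType R) (N : nat)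
    (T Q Rl C : nat -> H -> H) : set R :=
  [set lambda | strictly_positive (calF N T Q Rl C lambda) \/
                strictly_negative (calF N T Q Rl C lambda)].

(* Main.v *)
Require Import Defs.
From HB Require Import structures.
From mathcomp Require Import all_boot all_order all_algebra.
From mathcomp Require Import all_classical all_reals all_analysis.
From mathcomp Require Import complex ring lra zify.

Set Implicit Arguments.
Unset Strict Implicit.
Unset Printing Implicit Defensive.

Import Order.TTheory GRing.Theory Num.Theory numFieldNormedType.Exports.
Local Open Scope classical_set_scope.
Local Open Scope ring_scope.

(** Why the theorem holds.

    A generalised eigenvector is driven by transfer operators: the pair
    [(u n.-1, u n)] is mapped to [(u n, u n.+1)]. Let [S n] be the shifted Turan
    form, the real part of
    [<u (n+N-1), a (n+N-1) (u n)> - <a (n+N-1) (u (n+N)), u n.-1>].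
    Eliminating [u (n+N+1)] and [u n.+1] by the recurrence expresses
    [S n.+1 - S n] through the differences over one period of [a n^-1 b n] and
    [a n^-1 a_(n-1)^*] and through [z] times inverses of the [a n]
    ([turan_step]). The former are summable by the bounded variation, the latter
    because the Carleman series converges; hence the increments of [S] are
    summable relative to [|a n| (|u n.-1|^2 + |u n|^2)].

    Convergence of the Carleman series also makes [|a n|] tend to infinity, so
    all [T n] vanish and the limit form does not depend on [lambda]. Along the
    multiples of [N] the product of the transfer operators over a period
    converges to the limit product, uniformly for [z] in a bounded set, so the
    sign of the limit form at one [lambda] makes [S (k N)], up to sign and for
    large [k], comparable with [|a (k N)| |(u (kN-1), u (kN))|^2]
    ([turan_coercive]). A positive sequence with summable relative increments
    stays between two multiples of its initial value ([slowly_varying]). Between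
    two multiples of [N], and for small [n], the boundedness of the transfer
    operators and the comparability of the norms of consecutive [a n]
    ([alpha_step]) conclude ([two_sided_bound]).

    Since the inverses of [|a n|] are summable, every generalised eigenvector is
    square summable. The adjoint of the closed operator [A] is the maximal
    operator ([adj_jacobi_graph]), by summation by parts. Therefore its
    eigenvectors for [z] are exactly the solutions with prescribed [u 0] and
    [a 0 (u 1) = z u 0 - b 0 (u 0)], and evaluation at [0] is a homeomorphism
    onto [H]. In particular the adjoint has non-real eigenvalues, which a
    symmetric operator cannot have.

    A self-adjoint extension is the restriction [B] of the adjoint to those
    vectors whose image is orthogonal to the kernel of the adjoint. It contains
    [A] and this kernel, and from this alone the adjoint of [B] is contained in
    [B]. That [B] is symmetric is read off the Wronskian of two elements of [B]
    at [n]: it equals the Wronskian at [0] of the solutions for [z = 0] which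
    interpolate them at [n] and [n.+1], and orthogonality to the kernel makes half
    of the initial data of these solutions tend to zero while the other half
    stays bounded ([kernel_extension_symmetric]). *)

(** * Complex moduli and inner products *)

Section ComplexModulus.
Variable R : realType.
Implicit Types z w : R[i].

Definition absc z : R := complex.Re `|z|.

Lemma abscE z : (absc z)%:C%C = `|z|.
Proof. by rewrite RRe_real ?ger0_real. Qed.

Lemma absc_ge0 z : 0 <= absc z.
Proof. by rewrite -lecR abscE normr_ge0. Qed.

Lemma absc0_eq0 z : absc z = 0 -> z = 0.
Proof. by move=> z0; apply/eqP; rewrite -normr_eq0 -abscE z0. Qed.

Lemma abscM z w : absc (z * w) = absc z * absc w.
Proof. by apply: (@complexI R); rewrite rmorphM/= !abscE normrM. Qed.

Lemma ler_abscD z w : absc (z + w) <= absc z + absc w.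
Proof. by rewrite -lecR rmorphD/= !abscE ler_normD. Qed.

Lemma abscN z : absc (- z) = absc z.
Proof. by rewrite /absc normrN. Qed.

Lemma absc_conj z : absc z^* = absc z.
Proof. by rewrite /absc norm_conjC. Qed.

Lemma absc_real (r : R) : 0 <= r -> absc r%:C%C = r.
Proof. by move=> r0; rewrite /absc ger0_norm ?ler0c. Qed.

Lemma ReD z w : complex.Re (z + w) = complex.Re z + complex.Re w.
Proof. by case: z w => [? ?] [? ?]. Qed.

Lemma ImD z w : complex.Im (z + w) = complex.Im z + complex.Im w.
Proof. by case: z w => [? ?] [? ?]. Qed.

Lemma ReN z : complex.Re (- z) = - complex.Re z.
Proof. by case: z. Qed.

Lemma ReB z w : complex.Re (z - w) = complex.Re z - complex.Re w.
Proof. by rewrite ReD ReN. Qed.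

Lemma Re_conj z : complex.Re z^* = complex.Re z.
Proof. by case: z. Qed.

Lemma Re_realM (r : R) z : complex.Re (r%:C%C * z) = r * complex.Re z.
Proof. by case: z => x y /=; rewrite mul0r subr0. Qed.

Lemma ler_Re_absc z : `|complex.Re z| <= absc z.
Proof. by rewrite -lecR abscE normc_ge_Re. Qed.

Lemma Re_le_absc z : complex.Re z <= absc z.
Proof. exact: le_trans (ler_norm _) (ler_Re_absc z). Qed.

(** The factors [1] and ['i] already give the real and the imaginary part. *)
Lemma complex_eq0P z :
  (forall w, complex.Re (w * z) = 0) -> z = 0.
Proof.
case: z => x y h; have := h 1; have := h 'i%C; rewrite mul1r /= => y0 x0.
by apply/eqP; rewrite eq_complex/=; apply/andP; split; apply/eqP; lra.
Qed.

End ComplexModulus.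

Section DotTheory.
Variables (R : realType) (V : preHilbertType R).
Implicit Types (x y z : V) (c : R[i]) (r : R).

Lemma dotDl x y z : dotp (x + y) z = dotp x z + dotp y z.
Proof. exact: linearDl. Qed.

Lemma dotDr x y z : dotp z (x + y) = dotp z x + dotp z y.
Proof. exact: linearDr. Qed.

Lemma dotBl x y z : dotp (x - y) z = dotp x z - dotp y z.
Proof. exact: linearBl. Qed.

Lemma dotBr x y z : dotp z (x - y) = dotp z x - dotp z y.
Proof. exact: linearBr. Qed.

Lemma dotNl x z : dotp (- x) z = - dotp x z.
Proof. exact: linearNl. Qed.

Lemma dotNr x z : dotp z (- x) = - dotp z x.
Proof. exact: linearNr. Qed.

Lemma dot0l x : dotp 0 x = 0 :> R[i].
Proof. exact: linear0l. Qed.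

Lemma dot0r x : dotp x 0 = 0 :> R[i].
Proof. exact: linear0r. Qed.

Lemma dotZl c x y : dotp (c *: x) y = c * dotp x y.
Proof. exact: linearZl_LR. Qed.

Lemma dotZr c x y : dotp x (c *: y) = c^* * dotp x y.
Proof. exact: linearZr_LR. Qed.

Lemma dotC x y : dotp x y = (dotp y x)^*.
Proof. by rewrite hermC expr0 mul1r. Qed.

Lemma rnorm0 : rnorm (0 : V) = 0.
Proof. by rewrite /rnorm normr0. Qed.

Lemma rnormN x : rnorm (- x) = rnorm x.
Proof. by rewrite /rnorm normrN. Qed.

Lemma ler_rnormB x y : rnorm (x - y) <= rnorm x + rnorm y.
Proof. by rewrite -(rnormN y) ler_rnormD. Qed.

Lemma rnormBC x y : rnorm (x - y) = rnorm (y - x).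
Proof. by rewrite -rnormN opprB. Qed.

Lemma rnormZc c x : rnorm (c *: x) = absc c * rnorm x.
Proof. exact: rnormZ. Qed.

Lemma rnormZr r x : 0 <= r -> rnorm (r%:C%C *: x) = r * rnorm x.
Proof. by move=> r0; rewrite rnormZc absc_real. Qed.

Lemma absc_dot x y : absc (dotp x y) <= rnorm x * rnorm y.
Proof.
rewrite -lecR abscE rmorphM/= !rnormE.
by rewrite (le_trans (dot_CauchySchwarz _ _ _))// !dotp_norm !exprCK.
Qed.

Lemma dotpp x : dotp x x = (rnorm x ^+ 2)%:C%C.
Proof. by rewrite dotp_norm rmorphXn/= rnormE. Qed.

(** The real part of the inner product: an inner product over [R] inducing the
    same norm, on which the inequalities of the proof are carried out. *)
Definition rdot x y : R := complex.Re (dotp x y).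

Lemma rdotpp x : rdot x x = rnorm x ^+ 2.
Proof. by rewrite /rdot dotpp. Qed.

Lemma rdotC x y : rdot x y = rdot y x.
Proof. by rewrite /rdot dotC Re_conj. Qed.

Lemma rdotDl x y z : rdot (x + y) z = rdot x z + rdot y z.
Proof. by rewrite /rdot dotDl ReD. Qed.

Lemma rdotDr x y z : rdot z (x + y) = rdot z x + rdot z y.
Proof. by rewrite /rdot dotDr ReD. Qed.

Lemma rdotNl x z : rdot (- x) z = - rdot x z.
Proof. by rewrite /rdot dotNl ReN. Qed.

Lemma rdotNr x z : rdot z (- x) = - rdot z x.
Proof. by rewrite /rdot dotNr ReN. Qed.

Lemma rdotBl x y z : rdot (x - y) z = rdot x z - rdot y z.
Proof. by rewrite rdotDl rdotNl. Qed.

Lemma rdotBr x y z : rdot z (x - y) = rdot z x - rdot z y.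
Proof. by rewrite rdotDr rdotNr. Qed.

Lemma rdotZl r x y : rdot (r%:C%C *: x) y = r * rdot x y.
Proof. by rewrite /rdot dotZl Re_realM. Qed.

Lemma rdotZr r x y : rdot x (r%:C%C *: y) = r * rdot x y.
Proof. by rewrite rdotC rdotZl rdotC. Qed.

Lemma ler_rdot x y : `|rdot x y| <= rnorm x * rnorm y.
Proof. exact: le_trans (ler_Re_absc _) (absc_dot x y). Qed.

Lemma dot_inj x y : (forall z, dotp z x = dotp z y) -> x = y.
Proof.
move=> h; apply/eqP; rewrite -subr_eq0; apply/eqP/rnorm0_eq0/eqP.
by rewrite -sqrf_eq0 -rdotpp /rdot dotBr h subrr.
Qed.

Lemma rnormD_sqr x y :
  rnorm (x + y) ^+ 2 = rnorm x ^+ 2 + 2 * rdot x y + rnorm y ^+ 2.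
Proof.
rewrite -!rdotpp rdotDl !rdotDr (rdotC y x); ring.
Qed.

Lemma rnormB_sqr x y :
  rnorm (x - y) ^+ 2 = rnorm x ^+ 2 - 2 * rdot x y + rnorm y ^+ 2.
Proof. by rewrite rnormD_sqr rdotNr rnormN mulrN. Qed.

End DotTheory.

(* linear identities between vectors reduce to ring identities between their
   inner products with a fixed vector *)
Ltac vector_ring :=
  apply: dot_inj => ?;
  rewrite ?(dotDr, dotBr, dotNr, dotZr, dot0r); ring.

(** * Riesz representation and adjoints *)

Section Riesz.
Variables (R : realType) (H : hilbertType R).

Lemma rnorm_lt (V : normedModType R[i]) (x : V) (e : R) :
  (`|x| < e%:C%C) = (rnorm x < e).
Proof. by rewrite -rnormE ltcR. Qed.

(** Completeness of [H], whose norm is complex valued, for real radii. *)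
Lemma rcauchy_cvg (x : nat -> H) :
  (forall e : R, 0 < e ->
     exists n0, forall n, (n0 <= n)%N -> rnorm (x n0 - x n) < e) ->
  exists w, forall e : R, 0 < e ->
     exists n0, forall n, (n0 <= n)%N -> rnorm (w - x n) < e.
Proof.
move=> xC.
have real_pos (e : R[i]) : 0 < e -> 0 < complex.Re e /\ e = (complex.Re e)%:C%C.
  by move=> e0; rewrite -ltcR RRe_real ?gtr0_real.
have : cvg (x @ \oo).
  apply/cauchy_cvgP/cauchy_exP => e /real_pos[e0 eE].
  have [n0 hn0] := xC _ e0; exists (x n0); exists n0 => // n /= n0n.
  by rewrite -ball_normE/= eE rnorm_lt hn0.
move=> xw; exists (lim (x @ \oo)) => e e0.
have e0' : 0 < e%:C%C :> R[i] by rewrite ltcR.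
have /cvgrPdist_lt/(_ _ e0')[n0 _ hn0] : x n @[n --> \oo] --> lim (x @ \oo).
  exact: xw.
by exists n0 => n n0n; rewrite -rnorm_lt; exact: hn0.
Qed.

(** The representing vector minimises [x |-> |x|^2 - 2 Re (f x)]: by the
    parallelogram law every minimising sequence is a Cauchy sequence, and at its
    limit the first variation, which is [2 Re (<h, w> - f h)], vanishes. *)
Lemma riesz (f : H -> R[i]) (M : R) :
  (forall c x y, f (c *: x + y) = c * f x + f y) ->
  (forall x, absc (f x) <= M * rnorm x) ->
  exists w, forall x, f x = dotp x w.
Proof.
move=> flin fM.
have f0 : f 0 = 0.
  have := flin 1 0 0; rewrite scale1r mul1r addr0 => /eqP.
  by rewrite eq_sym -subr_eq0 addrK => /eqP.
have fD x y : f (x + y) = f x + f y by rewrite -[x]scale1r flin mul1r scale1r.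
have fZ c x : f (c *: x) = c * f x.
  by rewrite -[X in f X]addr0 flin f0 addr0.
pose J x := rnorm x ^+ 2 - 2 * complex.Re (f x).
have J_ge x : - M ^+ 2 <= J x.
  have := sqr_ge0 (rnorm x - M); have := le_trans (Re_le_absc _) (fM x).
  rewrite /J; nra.
have hasJ : has_inf (range J).
  by split; [exists (J 0), 0 | exists (- M ^+ 2) => _ [x _ <-]].
pose m := inf (range J).
have mJ x : m <= J x by apply: inf_lbound; [case: hasJ | exists x].
have /choice[x xP] : forall n, exists x, J x < m + n.+1%:R^-1.
  move=> n; have n0 : (0 : R) < n.+1%:R^-1 by rewrite invr_gt0.
  by have [_ [y _ <-] yP] := inf_adherent n0 hasJ; exists y.
have small (e : R) : 0 < e ->
    exists n0 : nat, forall n : nat, (n0 <= n)%N -> n.+1%:R^-1 < e :> R.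
  move=> e0; exists (Num.trunc e^-1) => n hn.
  rewrite -[ltRHS]invrK ltf_pV2 ?posrE ?invr_gt0//.
  by apply: lt_le_trans (truncnS_gt _) _; rewrite ler_nat.
have JP y z : rnorm (y - z) ^+ 2 <= 2 * (J y + J z - 2 * m).
  have := mJ ((2^-1 : R)%:C%C *: (y + z)).
  rewrite /J rnormZr ?invr_ge0// exprMn rnormD_sqr rnormB_sqr fZ Re_realM fD ReD.
  by move: (rdot y z) (complex.Re (f y)) (complex.Re (f z)) => *; lra.
have [e e0|w wP] := @rcauchy_cvg x.
  have e20 : 0 < e ^+ 2 / 8 by rewrite divr_gt0// exprn_gt0.
  have [n0 n0P] := small _ e20; exists n0 => n n0n.
  rewrite -(@ltr_pXn2r _ 2) ?nnegrE ?rnorm_ge0// ?(ltW e0)//.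
  apply: le_lt_trans (JP _ _) _.
  have := xP n0; have := xP n; have := n0P _ n0n; have := n0P _ (leqnn n0).
  move: e20; move: (J (x n)) (J (x n0)) => j j0.
  move: (n.+1%:R^-1) (n0.+1%:R^-1) => k k0.
  clearbody m; lra.
exists w => h.
(* the first variation of [J] at [w] in the direction [h] *)
have var t h' : 0 <= t * 2 * (rdot h' w - complex.Re (f h'))
    + t ^+ 2 * rnorm h' ^+ 2.
  rewrite leNgt; apply/negP; set e := _ + _; rewrite -oppr_gt0 => e0.
  pose d := `|t| * 2 * rnorm h' + 1.
  have d0 : 0 < d by rewrite ltr_wpDl// !mulr_ge0 ?rnorm_ge0.
  have ed0 : 0 < - e / (2 * d) by rewrite divr_gt0// mulr_gt0.
  have e20 : 0 < - e / 2 by rewrite divr_gt0.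
  have [n1 n1P] := wP _ ed0; have [n2 n2P] := small _ e20.
  pose n := maxn n1 n2.
  have := n1P n (leq_maxl _ _); have := n2P n (leq_maxr _ _).
  move=> hn wn; have := xP n; have := mJ (x n + t%:C%C *: h').
  have Jt : J (x n + t%:C%C *: h') = J (x n)
     + t * 2 * (rdot h' (x n) - complex.Re (f h')) + t ^+ 2 * rnorm h' ^+ 2.
    rewrite /J rnormD_sqr fD fZ ReD Re_realM rdotZr rdotC.
    have -> : rnorm (t%:C%C *: h') ^+ 2 = t ^+ 2 * rnorm h' ^+ 2.
      by rewrite -!rdotpp rdotZl rdotZr mulrA expr2.
    by ring.
  rewrite Jt => m1 m2.
  have dif : t * 2 * (rdot h' (x n) - rdot h' w) <= - e / 2.
    rewrite -rdotBr (le_trans (ler_norm _))// !normrM normr_nat.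
    have hr := ler_rdot h' (x n - w).
    have xw : rnorm (x n - w) <= - e / (2 * d) by rewrite rnormBC ltW.
    have t0 : 0 <= `|t| * 2 * rnorm h' by rewrite !mulr_ge0 ?rnorm_ge0.
    apply: (@le_trans _ _ (`|t| * 2 * rnorm h' * (- e / (2 * d)))).
      rewrite -[leRHS]mulrA ler_wpM2l ?mulr_ge0// (le_trans hr)//.
      by rewrite ler_wpM2l ?rnorm_ge0.
    rewrite invfM [X in _ * X]mulrA mulrCA ger_pMr// ler_pdivrMr// mul1r.
    by rewrite /d lerDl.
  move: m1 m2 dif hn; rewrite {1}/e /e; clearbody m.
  move: (J (x n)) (n.+1%:R^-1) (rdot h' (x n)) (rdot h' w) (t ^+ 2 * _) => j k r s q.
  move: (complex.Re (f h')) => l. nra.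
have re h' : complex.Re (f h') = rdot h' w.
  apply/eqP; rewrite -subr_eq0; apply/eqP.
  set g := complex.Re _ - _.
  have [h0|h0] := eqVneq (rnorm h' ^+ 2) 0.
    have := var 1 h'; have := var (-1) h'; rewrite h0 /g; lra.
  have hp : 0 < rnorm h' ^+ 2 by rewrite lt_def h0 sqr_ge0.
  have := var (g / rnorm h' ^+ 2) h'.
  have -> : rdot h' w - complex.Re (f h') = - g by rewrite opprB.
  have -> : g / rnorm h' ^+ 2 * 2 * - g
      + (g / rnorm h' ^+ 2) ^+ 2 * rnorm h' ^+ 2 = - (g ^+ 2 / rnorm h' ^+ 2).
    by field; rewrite -sqrf_eq0.
  rewrite oppr_ge0 pmulr_lle0 ?invr_gt0// => g2.
  by apply/eqP; rewrite -sqrf_eq0 eq_le g2 sqr_ge0.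
apply/eqP; rewrite -subr_eq0; apply/eqP/complex_eq0P => c.
by rewrite mulrBr ReB -fZ -dotZl re /rdot subrr.
Qed.

End Riesz.

Section Adjoint.
Variables (R : realType).

Definition has_adj (V : preHilbertType R) (X Y : V -> V) : Prop :=
  forall x y, dotp (X x) y = dotp x (Y y).

Lemma has_adjP (V : preHilbertType R) (X Y : V -> V) :
  has_adj X Y -> adj X = Y.
Proof.
move=> XY; apply/funext => y; rewrite /adj.
case: xgetP => [w _ hw|/(_ (Y y))[]//].
by apply: dot_inj => z; rewrite -XY hw.
Qed.

Lemma has_adjC (V : preHilbertType R) (X Y : V -> V) :
  has_adj X Y -> has_adj Y X.
Proof. by move=> XY x y; rewrite dotC -XY -dotC. Qed.

Lemma adjP (H : hilbertType R) (X : H -> H) : bounded_op X -> has_adj X (adj X).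
Proof.
move=> [Xlin [M XM]] x y; rewrite /adj.
case: xgetP => [w _ hw|noadj]; first exact: hw.
have [c u v|u|w wP] := @riesz _ _ (fun x => dotp (X x) y) (`|M| * rnorm y).
- by rewrite Xlin dotDl dotZl.
- rewrite (le_trans (absc_dot _ _))// mulrAC ler_wpM2r ?rnorm_ge0//.
  by rewrite (le_trans (XM u))// ler_wpM2r ?rnorm_ge0 ?ler_norm.
- by case: (noadj w).
Qed.

End Adjoint.

(** * Bounded operators and real series *)

Section BoundedOperatorTheory.
Variables (R : realType) (V : normedModType R[i]).
Implicit Types (X Y : V -> V) (x y : V).

Section LinearOp.
Variables (X : V -> V) (X_bounded : bounded_op X).

Lemma opD x y : X (x + y) = X x + X y.
Proof. by case: X_bounded => Xl _; rewrite -[x]scale1r Xl !scale1r. Qed.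

Lemma op0 : X 0 = 0.
Proof. by apply: (addIr (X 0)); rewrite -opD !add0r. Qed.

Lemma opZ c x : X (c *: x) = c *: X x.
Proof. by case: X_bounded => Xl _; rewrite -[c *: x]addr0 Xl op0 addr0. Qed.

Lemma opN x : X (- x) = - X x.
Proof. by rewrite -scaleN1r opZ scaleN1r. Qed.

Lemma opB x y : X (x - y) = X x - X y.
Proof. by rewrite opD opN. Qed.

Let E := [set rnorm (X x) | x in [set x : V | rnorm x <= 1]].

Let E_has_sup : has_sup E.
Proof.
split; first by exists (rnorm (X 0)), 0 => //=; rewrite /rnorm normr0 ler01.
case: X_bounded => _ [M XM]; exists `|M| => _ [x /= x1 <-].
rewrite (le_trans (XM x))// (@le_trans _ _ (`|M| * rnorm x))//.
  by rewrite ler_wpM2r ?rnorm_ge0 ?ler_norm.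
by rewrite -[leRHS]mulr1 ler_wpM2l.
Qed.

Lemma opnorm_bound x : rnorm (X x) <= opnorm X * rnorm x.
Proof.
have [x0|x0] := eqVneq (rnorm x) 0.
  by rewrite (rnorm0_eq0 x0) op0 /rnorm normr0 mulr0.
have xp : 0 < rnorm x by rewrite lt_def x0 rnorm_ge0.
rewrite -ler_pdivrMr// mulrC.
have normZ z : rnorm ((rnorm x)^-1%:C%C *: z) = (rnorm x)^-1 * rnorm z.
  by rewrite rnormZ ger0_norm ?ler0c ?invr_ge0 ?rnorm_ge0.
rewrite -normZ -opZ; apply: (ub_le_sup E_has_sup.2).
by exists ((rnorm x)^-1%:C%C *: x) => //=; rewrite normZ mulVf.
Qed.

Lemma opnorm_ge0 : 0 <= opnorm X.
Proof.
apply: le_trans (ub_le_sup E_has_sup.2 _); first exact: (rnorm_ge0 (X 0)).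
by exists 0 => //=; rewrite /rnorm normr0 ler01.
Qed.

End LinearOp.

Lemma opnorm_le X (M : R) :
  0 <= M -> (forall x, rnorm (X x) <= M * rnorm x) -> opnorm X <= M.
Proof.
move=> M0 XM; apply: ge_sup.
  by exists (rnorm (X 0)), 0 => //=; rewrite /rnorm normr0 ler01.
move=> _ [x /= x1 <-]; rewrite (le_trans (XM x))//.
by rewrite -[leRHS]mulr1 ler_wpM2l.
Qed.

Lemma bounded_op_comp X Y : bounded_op X -> bounded_op Y -> bounded_op (X \o Y).
Proof.
move=> bX bY; split=> [c x y|] /=; first by rewrite (opD bY) (opZ bY) (opD bX) (opZ bX).
exists (opnorm X * opnorm Y) => x /=; rewrite (le_trans (opnorm_bound bX _))//.
by rewrite -mulrA ler_wpM2l ?opnorm_ge0// opnorm_bound.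
Qed.

Lemma bounded_opB X Y : bounded_op X -> bounded_op Y -> bounded_op (X - Y).
Proof.
move=> bX bY; split=> [c x y|].
  rewrite !fctE (opD bX) (opZ bX) (opD bY) (opZ bY) opprD scalerDr scalerN.
  by rewrite addrACA.
exists (opnorm X + opnorm Y) => x; rewrite !fctE mulrDl.
rewrite (le_trans (ler_rnormD _ _))// lerD ?opnorm_bound//.
by rewrite /rnorm normrN; exact: opnorm_bound.
Qed.

Lemma bounded_opZ c X : bounded_op X -> bounded_op (c *: X).
Proof.
move=> bX; split=> [d x y|].
  by rewrite !fctE (opD bX) (opZ bX) scalerDr !scalerA mulrC.
exists (absc c * opnorm X) => x; rewrite !fctE rnormZ -mulrA.
by rewrite ler_wpM2l ?opnorm_bound// absc_ge0.
Qed.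

Lemma invopP X : boundedly_invertible X ->
  [/\ bounded_op (invop X), cancel X (invop X) & cancel (invop X) X].
Proof.
move=> [Y [bY XK YK]].
have -> : invop X = Y.
  apply/funext => y; rewrite -{1}[y]YK /invop.
  by apply: (pinvKV _ (A := setT)); rewrite ?inE// => u v _ _; exact: (can_inj XK).
by split.
Qed.

Lemma opnorm_invertible_gt0 X : (exists x : V, x != 0) ->
  bounded_op X -> boundedly_invertible X -> 0 < opnorm X.
Proof.
move=> [x /eqP x0] bX [Y [_ XK _]]; rewrite lt_def opnorm_ge0// andbT.
apply/eqP => X0; apply: x0; apply: (can_inj XK); rewrite (op0 bX).
apply: rnorm0_eq0; apply/eqP; rewrite eq_le rnorm_ge0 andbT.
by have := opnorm_bound bX x; rewrite X0 mul0r.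
Qed.

End BoundedOperatorTheory.

Lemma adj_rnorm_le (R : realType) (H : hilbertType R) (X : H -> H) y :
  bounded_op X -> rnorm (adj X y) <= opnorm X * rnorm y.
Proof.
move=> bX; have aX := adjP bX.
have [y0|y0] := eqVneq (rnorm (adj X y)) 0.
  by rewrite y0 mulr_ge0 ?opnorm_ge0 ?rnorm_ge0.
have yp : 0 < rnorm (adj X y) by rewrite lt_def y0 rnorm_ge0.
rewrite -(ler_pM2l yp) -expr2 -rdotpp /rdot -aX.
rewrite (le_trans (ler_norm _))// (le_trans (ler_rdot _ _))//.
by rewrite mulrCA mulrA ler_wpM2r ?rnorm_ge0 ?opnorm_bound.
Qed.

Lemma adj_bounded (R : realType) (H : hilbertType R) (X : H -> H) :
  bounded_op X -> bounded_op (adj X).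
Proof.
move=> bX; have aX := adjP bX; split=> [c x y|].
  by apply: dot_inj => z; rewrite -aX !dotDr !dotZr -!aX.
by exists (opnorm X) => y; exact: adj_rnorm_le.
Qed.

(** Together with [adj_rnorm_le] this is the equality of the norms of [X] and of
    its adjoint. *)
Lemma opnorm_le_adj (R : realType) (H : hilbertType R) (X : H -> H) :
  bounded_op X -> opnorm X <= opnorm (adj X).
Proof.
move=> bX; have baX := adj_bounded bX; have aX := adjP bX.
apply: opnorm_le => [|x]; first exact: opnorm_ge0.
have [x0|x0] := eqVneq (rnorm (X x)) 0.
  by rewrite x0 mulr_ge0 ?opnorm_ge0 ?rnorm_ge0.
have xp : 0 < rnorm (X x) by rewrite lt_def x0 rnorm_ge0.
rewrite -(ler_pM2l xp) -expr2 -rdotpp /rdot aX.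
rewrite (le_trans (ler_norm _))// (le_trans (ler_rdot _ _))//.
by rewrite mulrC mulrCA mulrA ler_wpM2r ?rnorm_ge0 ?opnorm_bound.
Qed.

Section RealSequences.
Variable R : realType.
Implicit Types (f g : nat -> R).

Lemma cvg0_eventually f : f n @[n --> \oo] --> (0 : R) ->
  forall e, 0 < e -> exists n0, forall n, (n0 <= n)%N -> `|f n| < e.
Proof.
move=> /cvgrPdist_lt f0 e e0; have [n0 _ n0P] := f0 _ e0.
by exists n0 => n /n0P/=; rewrite sub0r normrN.
Qed.

Lemma eventually_bounded f (M : R) n0 : (forall n, (n0 <= n)%N -> f n <= M) ->
  exists2 M' : R, 0 < M' & forall n, f n <= M'.
Proof.
move=> fM; exists (`|M| + \sum_(i < n0) `|f i| + 1).
  by rewrite ltr_wpDl// addr_ge0// sumr_ge0.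
move=> n; have [n0n|nn0] := leqP n0 n.
  rewrite (le_trans (fM _ n0n))// (le_trans (ler_norm _))// -addrA lerDl.
  by rewrite addr_ge0// sumr_ge0.
rewrite (le_trans (ler_norm _))// (bigD1 (Ordinal nn0))//= addrCA -addrA lerDl.
by rewrite !addr_ge0// sumr_ge0.
Qed.

(** Passing from extended-real series to bounds on partial sums keeps all later
    summability arguments within finite sums. *)
Lemma nneseries_bounded f n0 : (forall n, 0 <= f n) ->
  (\sum_(n0 <= n <oo) (f n)%:E < +oo)%E ->
  exists V : R, forall m, \sum_(n0 <= n < m) f n <= V.
Proof.
move=> f0 fV; exists (fine (\sum_(n0 <= n <oo) (f n)%:E)%E) => m.
have s0 : (0 <= \sum_(n0 <= n <oo) (f n)%:E)%E.
  by apply: nneseries_ge0 => n _ _; rewrite lee_fin.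
rewrite -lee_fin fineK ?ge0_fin_numE// -sumEFin.
by apply: nneseries_lim_ge => n _ _; rewrite lee_fin.
Qed.

Lemma bounded_series_tail f n0 (V : R) : (forall n, 0 <= f n) ->
  (forall m, \sum_(n0 <= n < m) f n <= V) ->
  forall e, 0 < e -> exists n1, forall m, \sum_(n1 <= n < m) f n <= e.
Proof.
move=> f0 fV e e0; pose E := range (fun m => \sum_(n0 <= n < m) f n).
have hE : has_sup E.
  by split; [exists (\sum_(n0 <= n < 0) f n), 0%N | exists V => _ [m _ <-]].
have [_ [m _ <-] mP] := sup_adherent e0 hE.
exists (maxn n0 m) => k; have [km|mk] := leqP k (maxn n0 m).
  by rewrite big_geq// ltW.
have mk' := ltnW mk.
have : \sum_(n0 <= n < k) f n <= sup E by apply: ub_le_sup; [case: hE|exists k].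
rewrite (big_cat_nat (leq_maxl n0 m) mk') /=.
have : \sum_(n0 <= n < m) f n <= \sum_(n0 <= n < maxn n0 m) f n.
  by have [mn|//] := leqP m n0; rewrite big_geq// sumr_ge0.
move: (\sum_(_ <= n < k) _) (\sum_(_ <= n < m) _) mP.
by move: (\sum_(_ <= n < maxn _ _) _) => *; lra.
Qed.

End RealSequences.

(** * Transfer operators and the Turan form *)

Section DirectSumTheory.
Variables (R : realType) (H : preHilbertType R).
Implicit Types u v : dsum H.

Lemma dsum_dotE u v : dotp u v = dotp u.1 v.1 + dotp u.2 v.2.
Proof. by []. Qed.

Lemma dsum_rnorm_sqr v : rnorm v ^+ 2 = rnorm v.1 ^+ 2 + rnorm v.2 ^+ 2.
Proof. by rewrite -!rdotpp /rdot dsum_dotE ReD. Qed.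

Lemma dsum_rnorm_fst v : rnorm v.1 <= rnorm v.
Proof.
rewrite -(@ler_pXn2r _ 2) ?nnegrE ?rnorm_ge0// dsum_rnorm_sqr.
by rewrite lerDl sqr_ge0.
Qed.

Lemma dsum_rnorm_snd v : rnorm v.2 <= rnorm v.
Proof.
rewrite -(@ler_pXn2r _ 2) ?nnegrE ?rnorm_ge0// dsum_rnorm_sqr.
by rewrite lerDr sqr_ge0.
Qed.

Lemma dsum_rnorm_le v : rnorm v <= rnorm v.1 + rnorm v.2.
Proof.
rewrite -(@ler_pXn2r _ 2) ?nnegrE ?addr_ge0 ?rnorm_ge0// dsum_rnorm_sqr.
by rewrite sqrrD lerD2r lerDl mulrn_wge0// mulr_ge0 ?rnorm_ge0.
Qed.

End DirectSumTheory.

Section CommutatorForm.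
Variables (R : realType) (H : preHilbertType R).
Implicit Types (X : H -> H) (y v : dsum H).

(** The real part of the quadratic form, at the pair [y], [v], of the block
    operator with rows [0, -X] and [X^*, 0]. The adjoint is moved to the other
    side of the inner product, which makes additivity in [X] immediate. *)
Definition commform X y v : R :=
  rdot y.1 (X v.2) - rdot (X y.2) v.1.

Lemma commformBl X Y y v :
  commform (X - Y) y v = commform X y v - commform Y y v.
Proof. by rewrite /commform !fctE rdotBl rdotBr; ring. Qed.

Lemma commformZl (c : R) X y v :
  commform (c%:C%C *: X) y v = c * commform X y v.
Proof. by rewrite /commform !fctE rdotZl rdotZr mulrBr. Qed.

Lemma commformBr X y y' v : bounded_op X ->
  commform X (y - y') v = commform X y v - commform X y' v.
Proof. by move=> bX; rewrite /commform /= (opB bX) !rdotBl; ring. Qed.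

Lemma ler_commform X y v : bounded_op X ->
  `|commform X y v| <= 2 * opnorm X * rnorm y * rnorm v.
Proof.
move=> bX; rewrite /commform (le_trans (ler_normB _ _))//.
have X0 := opnorm_ge0 bX.
have h1 : `|rdot y.1 (X v.2)| <= opnorm X * rnorm y * rnorm v.
  rewrite (le_trans (ler_rdot _ _))//.
  rewrite (le_trans (ler_pM _ _ (dsum_rnorm_fst y) (opnorm_bound _ _))) ?rnorm_ge0//.
  by rewrite mulrCA mulrA ler_wpM2l ?dsum_rnorm_snd// mulr_ge0 ?rnorm_ge0.
have h2 : `|rdot (X y.2) v.1| <= opnorm X * rnorm y * rnorm v.
  rewrite (le_trans (ler_rdot _ _))//.
  rewrite (le_trans (ler_pM _ _ (opnorm_bound _ _) (dsum_rnorm_fst v))) ?rnorm_ge0//.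
  by rewrite ler_wpM2r ?rnorm_ge0// ler_wpM2l ?dsum_rnorm_snd.
by rewrite (le_trans (lerD h1 h2))// -!mulrA mulr2n mulrDl mul1r.
Qed.

End CommutatorForm.

Section Transfer.
Variables (R : realType) (H : hilbertType R) (a b : nat -> H -> H).
Hypothesis a_bounded : forall n, bounded_op (a n).
Hypothesis a_inv : forall n, boundedly_invertible (a n).
Hypothesis b_bounded : forall n, bounded_op (b n).
Hypothesis b_sa : forall n, self_adjoint_op (b n).
Implicit Types (z : R[i]) (u v : nat -> H).

(** The recurrence is imposed from index [1] on, so the values [u 0] and [u 1]
    are free. *)
Definition solves z u : Prop :=
  forall n, (1 <= n)%N -> jacobi a b u n = z *: u n.

Definition adjacent u n : dsum H := (u n.-1, u n).

Definition transfer z n : dsum H -> dsum H :=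
  op_block 0 idfun (- (invop (a n) \o adj (a n.-1)))
    (z *: invop (a n) - (invop (a n) \o b n)).
Arguments transfer : simpl never.

Let ia_bounded n : bounded_op (invop (a n)).
Proof. by case: (invopP (a_inv n)). Qed.

Let iaK n : cancel (a n) (invop (a n)).
Proof. by case: (invopP (a_inv n)). Qed.

Let aiK n : cancel (invop (a n)) (a n).
Proof. by case: (invopP (a_inv n)). Qed.

Lemma transferE z n (v : dsum H) : transfer z n v =
  (v.2, z *: invop (a n) v.2 - invop (a n) (b n v.2)
        - invop (a n) (adj (a n.-1) v.1)).
Proof.
rewrite /transfer /op_block !fctE add0r; by congr (_, _); vector_ring.
Qed.

Lemma solves_transfer z u n : solves z u -> (1 <= n)%N ->
  adjacent u n.+1 = transfer z n (adjacent u n).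
Proof.
move=> uz n1; rewrite transferE /adjacent/=; congr (_, _).
move: (uz n n1); case: n n1 => // n _ /= eu.
apply: (can_inj (@iaK n.+1)); rewrite !(opB (a_bounded _)) (opZ (a_bounded _)).
by rewrite !aiK -eu; vector_ring.
Qed.

Lemma transfer_solves z u :
  (forall n, adjacent u n.+2 = transfer z n.+1 (adjacent u n.+1)) -> solves z u.
Proof.
move=> uT [//|n] _; move: (uT n); rewrite transferE /adjacent/= => -[->].
rewrite !(opB (a_bounded _)) (opZ (a_bounded _)) !aiK.
by vector_ring.
Qed.

Fixpoint forward z (w : dsum H) n : dsum H :=
  if n is m.+1 then transfer z n (forward z w m) else w.

Definition forward_solution z (w : dsum H) n : H :=
  if n is m.+1 then (forward z w m).2 else w.1.

Lemma adjacent_forward z w n :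
  adjacent (forward_solution z w) n.+1 = forward z w n.
Proof.
case: n => [|n]; first by case: w.
have fE : forward z w n.+1 = transfer z n.+1 (forward z w n) by [].
change (((forward z w n).2, (forward z w n.+1).2) = forward z w n.+1).
by rewrite fE transferE.
Qed.

Lemma forward_solves z w : solves z (forward_solution z w).
Proof. by apply: transfer_solves => n; rewrite !adjacent_forward. Qed.

(** Since every [a n] is invertible, the recurrence can be run backwards. *)
Lemma transfer_surj z n (w : dsum H) : exists w' : dsum H, transfer z n.+1 w' = w.
Proof.
have aa := adjP (a_bounded n).
pose ai := adj (invop (a n)).
have aiP y : adj (a n) (ai y) = y.
  by apply: dot_inj => x; rewrite -aa -(adjP (ia_bounded n)) iaK.
exists (ai (z *: w.1 - b n.+1 w.1 - a n.+1 w.2), w.1).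
rewrite transferE/= aiP !(opB (ia_bounded _)) (opZ (ia_bounded _)) iaK.
by case: w => p q /=; congr (_, _); vector_ring.
Qed.

Lemma solution_through z n (w : dsum H) :
  exists2 u, solves z u & adjacent u n.+1 = w.
Proof.
elim: n w => [|n IHn] w.
  by exists (forward_solution z w); [exact: forward_solves|case: w].
have [v vw] := transfer_surj z n w; have [u uz uv] := IHn v.
by exists u => //; rewrite (solves_transfer uz)// uv.
Qed.

Lemma solution_unique z u v : solves z u -> solves z v ->
  u 0%N = v 0%N -> u 1%N = v 1%N -> u = v.
Proof.
move=> uz vz uv0 uv1; apply/funext => n.
suff : adjacent u n.+1 = adjacent v n.+1 by move=> [].
elim: n => [|n IHn]; first by rewrite /adjacent/= uv0 uv1.
by rewrite (solves_transfer uz (ltn0Sn n)) (solves_transfer vz (ltn0Sn n)) IHn.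
Qed.

Lemma solves_op_prod z u m n : solves z u -> (1 <= m)%N ->
  adjacent u (m + n) = op_prod (fun i => transfer z (m + i)) n (adjacent u m).
Proof.
move=> uz m1; elim: n => [|n IHn]; first by rewrite addn0.
by rewrite addnS (solves_transfer uz) ?IHn//; lia.
Qed.

(** For scalar coefficients this is the [N]-shifted Turan determinant
    [a_(n+N-1) (u_n u_(n+N-1) - u_(n-1) u_(n+N))]. *)
Definition turan N u n : R :=
  commform (a (n + N).-1) (adjacent u (n + N)) (adjacent u n).

(** Eliminating [u (n + N).+1] and then [u n.+1] through the recurrence leaves
    only differences over one period, and terms carrying an inverse of [a]. *)
Lemma turan_step N z u n : solves z u -> (1 <= n)%N ->
  turan N u n.+1 - turan N u n = rdot (u (n + N)%N) (a (n + N) (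
    (invop (a (n + N)) (adj (a (n + N).-1) (u n.-1))
       - invop (a n) (adj (a n.-1) (u n.-1)))
    + (invop (a (n + N)) (b (n + N) (u n)) - invop (a n) (b n (u n)))
    + (z *: invop (a n) (u n) - z^* *: invop (a (n + N)) (u n)))).
Proof.
move=> uz n1; rewrite /turan /commform addSn /=.
have [m mE] : exists m, (n + N)%N = m.+1 by exists (n + N).-1; lia.
have un1 : u n.+1 = z *: invop (a n) (u n) - invop (a n) (b n (u n))
        - invop (a n) (adj (a n.-1) (u n.-1)).
  by have := solves_transfer uz n1; rewrite transferE => -[].
have um1 : a m.+1 (u m.+2) = z *: u m.+1 - b m.+1 (u m.+1) - adj (a m) (u m).
  have := uz m.+1 isT => /= <-.
  by vector_ring.
rewrite mE /= um1 !rdotBl.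
have -> : rdot (adj (a m) (u m)) (u n) = rdot (u m) (a m (u n)).
  by rewrite rdotC /rdot -(adjP (a_bounded m)) dotC Re_conj.
have -> : rdot (a m (u m.+1)) (u n.-1) = rdot (u m.+1) (adj (a m) (u n.-1)).
  by rewrite /rdot (adjP (a_bounded m)).
have -> : rdot (b m.+1 (u m.+1)) (u n) = rdot (u m.+1) (b m.+1 (u n)).
  by rewrite /rdot (adjP (b_bounded m.+1)) b_sa.
have -> : rdot (z *: u m.+1) (u n) = rdot (u m.+1) (z^* *: u n).
  by rewrite /rdot dotZl dotZr conjCK.
have -> : a m.+1 (invop (a m.+1) (adj (a m) (u n.-1)) -
     invop (a n) (adj (a n.-1) (u n.-1)) +
     (invop (a m.+1) (b m.+1 (u n)) - invop (a n) (b n (u n))) +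
     (z *: invop (a n) (u n) - z^* *: invop (a m.+1) (u n)))
   = a m.+1 (u n.+1) + adj (a m) (u n.-1) + b m.+1 (u n) - z^* *: u n.
  rewrite un1 !(opD (a_bounded m.+1), opN (a_bounded m.+1), opZ (a_bounded m.+1)).
  rewrite !aiK.
  move: (a m.+1 (invop (a n) (u n))) (a m.+1 (invop (a n) (b n (u n)))) => p q.
  move: (a m.+1 (invop (a n) _)) (adj _ _) (b _ _) (z *: p) (z^* *: _) => r s t p' z'.
  by vector_ring.
rewrite rdotBr !rdotDr.
lra.
Qed.

End Transfer.

(** * Two-sided bounds for generalised eigenvectors *)

Section BlockArithmetic.
Variable N : nat.
Implicit Types i j k n : nat.

Lemma block_end_succ n k j : n.+1 = (k * N + j)%N -> (j < N)%N ->
  (k * N + N = n.+2 + (N - j.+1))%N.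
Proof. by move=> -> jN; rewrite -addnS -addnA subnKC. Qed.

Lemma block_shift k i : (1 <= N)%N ->
  (k * N + i + N = (k * N + N).-1 + i.+1)%N.
Proof. lia. Qed.

Lemma block_last k j : (j < N)%N -> (k * N + j + (N.-1 - j) = (k * N + N).-1)%N.
Proof. lia. Qed.

Lemma block_next_last k j : (j < N)%N ->
  (k * N + j + (N + (N.-1 - j)) = (k.+1 * N + N).-1)%N.
Proof. lia. Qed.

Lemma block_next k j : (j < N)%N -> (k * N + j + (N - j) = k.+1 * N)%N.
Proof. lia. Qed.

End BlockArithmetic.

Section SlowVariation.
Variable R : realType.

(** The hypotheses bound [s k] between the products of [1 - eps j] and
    [1 + eps j]; both products are controlled by the sum of the [eps j], without
    any exponential, as long as this sum is at most [1/2]. *)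
Lemma slowly_varying (s eps : nat -> R) k1 :
  (forall k, (k1 <= k)%N -> 0 <= s k) -> (forall k, 0 <= eps k) ->
  (forall k, (k1 <= k)%N -> `|s k.+1 - s k| <= eps k * s k) ->
  (forall m, \sum_(k1 <= k < m) eps k <= 2^-1) ->
  forall k, (k1 <= k)%N -> s k <= 2 * s k1 /\ s k1 <= 2 * s k.
Proof.
move=> s0 e0 sS eV k k1k.
have P0 m : 0 <= \sum_(k1 <= j < m) eps j by rewrite sumr_ge0.
suff [] : s k * (1 - \sum_(k1 <= j < k) eps j) <= s k1 /\
    s k1 * (1 - \sum_(k1 <= j < k) eps j) <= s k.
  move: (eV k) (P0 k) (s0 _ k1k) (s0 _ (leqnn k1)).
  by move: (\sum_(_ <= _ < _) _) => P *; split; nra.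
elim: k k1k => [|k IHk].
  by rewrite leqn0 => /eqP->; rewrite big_geq// subr0 !mulr1.
rewrite leq_eqVlt => /orP[/eqP<-|]; first by rewrite big_geq// subr0 !mulr1.
rewrite ltnS => k1k; rewrite big_nat_recr//=.
have [h1 h2] := IHk k1k.
have := sS _ k1k; rewrite ler_norml => /andP[h3 h4].
have := eV k.+1; rewrite big_nat_recr//=.
move: (P0 k) (e0 k) (s0 _ k1k) (s0 _ (leqW k1k)) (s0 _ (leqnn k1)) h1 h2 h3 h4.
move: (\sum_(_ <= _ < _) _) (eps k) (s k) (s k.+1) (s k1) => P e x y x1.
move=> P_ge e_ge x_ge y_ge x1_ge h1 h2 h3 h4 h5; split.
  have : (1 + e) * (1 - (P + e)) <= 1 - P by nra.
  have : y * (1 - (P + e)) <= x * ((1 + e) * (1 - (P + e))) by nra.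
  nra.
have : (1 - (P + e)) <= (1 - e) * (1 - P) by nra.
nra.
Qed.

(** Finitely many exceptional indices do not affect the existence of a uniform
    constant. *)
Lemma uniform_bound (P : nat -> R -> Prop) :
  (forall n c d, c <= d -> P n c -> P n d) -> (forall n, exists c, P n c) ->
  (exists c n1, forall n, (n1 <= n)%N -> P n c) ->
  exists2 c : R, 0 < c & forall n, P n c.
Proof.
move=> Pmono /choice[f fP] [c [n1 cP]].
have [n nn|M M0 MP] := @eventually_bounded _
  (fun n => if (n1 <= n)%N then c else f n) c n1; first by rewrite nn.
exists M => // n; apply: Pmono (MP n) _.
by case: ifPn => // nn; exact: cP.
Qed.

Lemma sum_nat_blocks (D : nat -> R) N k m :
  \sum_(k <= j < m) \sum_(i < N) D (j * N + i)%N
    = \sum_(k * N <= n < m * N) D n.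
Proof.
have [km|mk] := leqP k m; last first.
  by rewrite !big_geq// ?leq_mul2r ltnW ?orbT.
elim: m km => [|m IHm].
  by rewrite leqn0 => /eqP->; rewrite !big_geq.
rewrite leq_eqVlt => /orP[/eqP->|]; first by rewrite !big_geq.
rewrite ltnS => km; rewrite big_nat_recr//= IHm// mulSn addnC.
rewrite [RHS](@big_cat_nat _ _ _ (m * N))/= ?leq_addr ?leq_mul2r ?km ?orbT//.
congr (_ + _); rewrite -{2}[(m * N)%N]add0n big_addn addKn big_mkord.
by apply: eq_bigr => i _; rewrite addnC.
Qed.

End SlowVariation.

Section TwoSidedBound.
Variables (R : realType) (H : hilbertType R) (a b : nat -> H -> H) (N : nat).
Hypothesis H_neq0 : exists x : H, x != 0.
Hypothesis a_bounded : forall n, bounded_op (a n).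
Hypothesis a_inv : forall n, boundedly_invertible (a n).
Hypothesis b_bounded : forall n, bounded_op (b n).
Hypothesis b_sa : forall n, self_adjoint_op (b n).
Hypothesis N_ge1 : (1 <= N)%N.

Local Notation alpha n := (opnorm (a n)).
Local Notation IA n := (invop (a n)).
Local Notation IB n := (invop (a n) \o b n).
Local Notation IR n := (invop (a n) \o adj (a n.-1)).
Local Notation step z k := (op_prod (fun i => transfer a b z (k * N + i)) N).

Variables M V : R.
Hypothesis M_gt0 : 0 < M.
Hypothesis IA_le : forall n x, rnorm (IA n x) <= M / alpha n * rnorm x.
Hypothesis IB_le : forall n x, rnorm (IB n x) <= M * rnorm x.
Hypothesis IR_le : forall n x, rnorm (IR n x) <= M * rnorm x.
Hypothesis alpha_sum : forall m, \sum_(0 <= n < m) (alpha n)^-1 <= V.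
Hypothesis IB_sum :
  forall m, \sum_(0 <= n < m) opnorm (IB (n + N)%N - IB n) <= V.
Hypothesis IR_sum :
  forall m, \sum_(1 <= n < m) opnorm (IR (n + N)%N - IR n) <= V.

Variable s : R.
Hypothesis s_sign : `|s| = 1.
Hypothesis turan_coercive : forall r : R, exists2 c : R, 0 < c &
  exists k0, forall k z (v : dsum H), (k0 <= k)%N -> absc z <= r ->
    c * alpha (k * N + N).-1 * rnorm v ^+ 2
      <= s * commform (a (k * N + N).-1) (step z k v) v.

Let IA_bounded n : bounded_op (IA n).
Proof. by case: (invopP (a_inv n)). Qed.

Let aiK n : cancel (IA n) (a n).
Proof. by case: (invopP (a_inv n)). Qed.

Let IB_bounded n : bounded_op (IB n).
Proof. exact: bounded_op_comp. Qed.

Let IR_bounded n : bounded_op (IR n).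
Proof. by apply: bounded_op_comp => //; exact: adj_bounded. Qed.

Let alpha_gt0 n : 0 < alpha n.
Proof. exact: opnorm_invertible_gt0. Qed.

Let alphaV_le n : (alpha n)^-1 <= V.
Proof.
apply: le_trans (alpha_sum n.+1); rewrite big_nat_recr//= lerDr sumr_ge0// => i _.
by rewrite invr_ge0 ltW.
Qed.

Let V_ge0 : 0 <= V.
Proof. by apply: le_trans (alphaV_le 0); rewrite invr_ge0 ltW. Qed.

Let transfer_le (r : R) : 0 <= r -> exists2 K : R, 1 <= K &
  forall z n v, absc z <= r -> rnorm (transfer a b z n v) <= K * rnorm v.
Proof.
move=> r0; exists (1 + r * (M * V) + M + M).
  by rewrite -!addrA lerDl !addr_ge0 ?mulr_ge0// ltW.
move=> z n v zr; apply: (le_trans (dsum_rnorm_le _)).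
rewrite transferE/=; have v1 := dsum_rnorm_fst v; have v2 := dsum_rnorm_snd v.
have v0 := rnorm_ge0 v.
rewrite 3!mulrDl mul1r -!addrA lerD// !addrA.
apply: (le_trans (ler_rnormB _ _)); apply: lerD; last first.
  by rewrite (le_trans (IR_le _ _))// ler_wpM2l// ltW.
apply: (le_trans (ler_rnormB _ _)); apply: lerD; last first.
  by rewrite (le_trans (IB_le _ _))// ler_wpM2l// ltW.
rewrite rnormZc -mulrA ler_pM ?absc_ge0 ?rnorm_ge0//.
rewrite (le_trans (IA_le _ _))// ler_pM ?rnorm_ge0//.
  by rewrite divr_ge0// ltW.
by rewrite ler_wpM2l// ltW.
Qed.

Let IR_rnorm_le n x : rnorm (IR n.+1 x) <= M / alpha n.+1 * (alpha n * rnorm x).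
Proof.
rewrite (le_trans (IA_le _ _))//= ler_wpM2l ?adj_rnorm_le//.
by rewrite divr_ge0// ltW.
Qed.

Let commform_le n (y v : dsum H) :
  `|commform (a n) y v| <= 2 * alpha n * rnorm y * rnorm v.
Proof. exact: ler_commform. Qed.

Section Iterates.
Variables (r K : R).
Hypothesis K_ge1 : 1 <= K.
Hypothesis K_le : forall z n v, absc z <= r ->
  rnorm (transfer a b z n v) <= K * rnorm v.
Variables (z : R[i]) (u : nat -> H).
Hypothesis zr : absc z <= r.
Hypothesis uz : solves a b z u.

Let K_ge0 : 0 <= K. Proof. exact: le_trans K_ge1. Qed.

Lemma adjacent_le n j : (1 <= n)%N ->
  rnorm (adjacent u (n + j)) <= K ^+ j * rnorm (adjacent u n).
Proof.
move=> n1; elim: j => [|j IHj]; first by rewrite addn0 expr0 mul1r.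
rewrite addnS (solves_transfer a_bounded a_inv uz) ?addn_gt0 ?n1//.
by rewrite (le_trans (K_le _ _ zr))// exprS -mulrA ler_wpM2l.
Qed.

Lemma adjacent_le_max n j m : (1 <= n)%N -> (j <= m)%N ->
  rnorm (adjacent u (n + j)) <= K ^+ m * rnorm (adjacent u n).
Proof.
move=> n1 jm; rewrite (le_trans (adjacent_le _ n1))// ler_wpM2r ?rnorm_ge0//.
by rewrite ler_weXn2l.
Qed.

End Iterates.

Let step_solution z u k : solves a b z u -> (1 <= k)%N ->
  step z k (adjacent u (k * N)) = adjacent u (k * N + N).
Proof.
by move=> uz k1; rewrite (solves_op_prod a_bounded a_inv _ uz)// muln_gt0 k1.
Qed.

(** The growth of [a n] over one step is controlled by testing the coercive form
    on the solution passing through [(x, 0)]: the transfer operator shrinks this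
    vector by a factor [alpha n / alpha n.+1], but a product of transfer operators
    over a whole period cannot shrink vectors. *)
Let alpha_step : exists2 L : R, 1 <= L &
  forall n, alpha n.+1 <= L * alpha n /\ alpha n <= L * alpha n.+1.
Proof.
have [L L0 LP] : exists2 L : R, 0 < L & forall n, alpha n.+1 <= L * alpha n.
  apply: uniform_bound => [n c d cd|n|].
  - by move=> h; apply: (le_trans h); rewrite ler_wpM2r// ltW.
  - by exists (alpha n.+1 / alpha n); rewrite divfK// gt_eqF.
  have [K K1 KP] := transfer_le (lexx 0).
  have [c c0 [k0 cP]] := turan_coercive 0.
  exists (K ^+ N * (2 / c * (K ^+ N * M))), (k0.+1 * N)%N => n nk.
  have [x x0] := H_neq0; have z0 : absc (0 : R[i]) <= 0 by rewrite /absc normr0.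
  (* going back to the start [k N] of the period that contains [n.+1] *)
  have [u uz uw] := solution_through b a_bounded a_inv 0 n ((x, 0) : dsum H).
  pose k := (n.+1 %/ N)%N; pose j := (n.+1 %% N)%N.
  have nE : n.+1 = (k * N + j)%N by exact: divn_eq.
  have jN : (j < N)%N by rewrite ltn_mod.
  have kk0 : (k0 < k)%N by rewrite leq_divRL// (leq_trans nk).
  have k1 : (1 <= k)%N by exact: leq_ltn_trans kk0.
  have kN1 : (1 <= k * N)%N by rewrite muln_gt0 k1.
  have K0 : 0 <= K by exact: le_trans K1.
  set v := adjacent u (k * N).
  have wv : rnorm x <= K ^+ N * rnorm v.
    apply: le_trans (adjacent_le_max K1 KP z0 uz kN1 (ltnW jN)).
    by rewrite -nE uw; exact: (dsum_rnorm_fst ((x, 0) : dsum H)).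
  have Xv : rnorm (adjacent u (k * N + N)) <= K ^+ N * rnorm (IR n.+1 x).
    rewrite (block_end_succ nE jN).
    rewrite (le_trans (adjacent_le_max K1 KP z0 uz _ (leq_subr j.+1 N)))//.
    rewrite ler_wpM2l ?exprn_ge0// (solves_transfer a_bounded a_inv uz)// uw.
    rewrite (le_trans (dsum_rnorm_le _))// transferE/=.
    rewrite rnorm0 scale0r (op0 (b_bounded _)) (op0 (IA_bounded _)) subrr !add0r.
    by rewrite rnormN.
  have cv : rnorm v <= 2 / c * rnorm (adjacent u (k * N + N)).
    have [v0|v0] := eqVneq (rnorm v) 0.
      by rewrite v0 mulr_ge0 ?rnorm_ge0// divr_ge0 ?ltW.
    have vp : 0 < rnorm v by rewrite lt_def v0 rnorm_ge0.
    rewrite mulrAC ler_pdivlMr// mulrC -(ler_pM2r vp).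
    have := cP k 0 v (ltnW kk0) z0; rewrite step_solution//.
    move=> /le_trans/(_ (ler_norm _)); rewrite normrM s_sign mul1r.
    move=> /le_trans/(_ (commform_le _ _ _)).
    set al := alpha _ => h; rewrite -(ler_pM2l (alpha_gt0 (k * N + N).-1)).
    by move: h; rewrite -/al; congr (_ <= _); ring.
  have IRx := IR_rnorm_le n x.
  have xp : 0 < rnorm x.
    by rewrite lt_def rnorm_ge0 andbT; apply: contra x0 => /eqP/rnorm0_eq0->.
  have K20 : 0 <= K ^+ N by rewrite exprn_ge0.
  have c20 : 0 <= 2 / c by rewrite divr_ge0// ltW.
  rewrite -(ler_pM2r xp).
  have /(ler_wpM2l (ltW (alpha_gt0 n.+1))) : rnorm x <=
      K ^+ N * (2 / c * (K ^+ N * (M / alpha n.+1 * (alpha n * rnorm x)))).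
    rewrite (le_trans wv)// ler_wpM2l// (le_trans cv)// ler_wpM2l//.
    by rewrite (le_trans Xv)// ler_wpM2l.
  move=> /le_trans; apply.
  have an0 : alpha n.+1 != 0 by rewrite gt_eqF.
  move: an0; move: (alpha n.+1) (alpha n) (K ^+ N) (rnorm x) (2 / c).
  by move=> p q k' y d p0; rewrite le_eqVlt; apply/orP; left; apply/eqP; field.
have easy n : alpha n <= M * alpha n.+1.
  rewrite (le_trans (opnorm_le_adj (a_bounded n)))//.
  apply: opnorm_le => [|x]; first by rewrite mulr_ge0// ltW.
  have -> : adj (a n) x = a n.+1 (IR n.+1 x) by rewrite /= aiK.
  rewrite (le_trans (opnorm_bound (a_bounded _) _))// [M * _]mulrC -mulrA.
  by rewrite ler_wpM2l// ltW.
exists (L + M + 1) => [|n]; first by rewrite lerDr addr_ge0// ltW.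
split.
- apply: (le_trans (LP n)); apply: ler_wpM2r; first exact: ltW.
  by rewrite -addrA lerDl addr_ge0// ltW.
- apply: (le_trans (easy n)); apply: ler_wpM2r; first exact: ltW.
  by rewrite [L + M]addrC -addrA lerDl addr_ge0// ltW.
Qed.

Let alpha_shift : exists2 L : R, 1 <= L & forall n j m, (j <= m)%N ->
  alpha (n + j) <= L ^+ m * alpha n /\ alpha n <= L ^+ m * alpha (n + j).
Proof.
have [L L1 LP] := alpha_step; exists L => // n j m.
have L0 : 0 <= L by exact: le_trans L1.
elim: m j => [|m IHm] j.
  by rewrite leqn0 => /eqP->; rewrite addn0 expr0 mul1r.
have mon p q : p <= L ^+ m * q -> 0 <= q -> p <= L ^+ m.+1 * q.
  move=> h q0; apply: (le_trans h); rewrite ler_wpM2r//.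
  by rewrite ler_weXn2l.
rewrite leq_eqVlt ltnS => /orP[/eqP->|jm]; last first.
  by have [h1 h2] := IHm _ jm; split; apply: mon => //; exact: ltW.
have [h1 h2] := IHm _ (leqnn m); rewrite addnS.
have [h3 h4] := LP (n + m)%N; split.
- by rewrite (le_trans h3)// exprS -mulrA ler_wpM2l.
- by rewrite (le_trans h2)// exprSr -mulrA ler_wpM2l ?exprn_ge0.
Qed.

(** Up to a constant, a bound for the relative increment of the Turan form at [n]
    when [|z| <= r]. *)
Let D (r : R) n : R := opnorm (IR (n + N)%N - IR n) + opnorm (IB (n + N)%N - IB n)
  + r * M * ((alpha n)^-1 + (alpha (n + N))^-1).

Let D_ge0 r n : 0 <= r -> 0 <= D r n.
Proof.
move=> r0; rewrite !addr_ge0 ?mulr_ge0 ?addr_ge0 ?invr_ge0 ?opnorm_ge0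
  ?(ltW M_gt0) ?(ltW (alpha_gt0 _))//.
- exact: bounded_opB.
- exact: bounded_opB.
Qed.

Let D_sum r : 0 <= r -> exists W : R, forall m, \sum_(1 <= n < m) D r n <= W.
Proof.
move=> r0; exists (V + V + r * M * (V + V)) => m.
have drop (f : nat -> R) k : (forall n, 0 <= f n) ->
    \sum_(k <= n < m) f n <= \sum_(0 <= n < m) f n.
  move=> f0; have [km|mk] := leqP k m; last by rewrite big_geq ?sumr_ge0// ltnW.
  by rewrite [leRHS](big_cat_nat (leq0n k) km)/= lerDr sumr_ge0.
have aV n : 0 <= (alpha n)^-1 by rewrite invr_ge0 ltW.
rewrite !big_split/= -mulr_sumr big_split/=.
apply: lerD; [apply: lerD => //|].
  rewrite (le_trans _ (IB_sum m))//; apply: drop => n.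
  by apply: opnorm_ge0; exact: bounded_opB.
apply: ler_wpM2l; first by rewrite mulr_ge0// ltW.
apply: lerD; first by rewrite (le_trans _ (alpha_sum m))// drop.
rewrite (le_trans (drop (fun n => (alpha (n + N))^-1) 1%N _))//.
have -> : \sum_(0 <= n < m) (alpha (n + N))^-1
    = \sum_(N <= n < m + N) (alpha n)^-1.
  by rewrite -{2}[N]add0n big_addn addnK.
apply: le_trans (alpha_sum (m + N)).
by rewrite [leRHS](big_cat_nat (leq0n N) (leq_addl m N))/= lerDr sumr_ge0.
Qed.

Let turan_diff r K z u n : 1 <= K ->
  (forall z n v, absc z <= r -> rnorm (transfer a b z n v) <= K * rnorm v) ->
  absc z <= r -> solves a b z u -> (1 <= n)%N ->
  `|turan a N u n.+1 - turan a N u n|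
    <= K ^+ N * (alpha (n + N) * D r n) * rnorm (adjacent u n) ^+ 2.
Proof.
move=> K1 KP zr uz n1.
rewrite (turan_step a_bounded a_inv b_bounded b_sa N uz n1).
rewrite (le_trans (ler_rdot _ _))//.
set w := adjacent u n.
have un : rnorm (u n) <= rnorm w by exact: (dsum_rnorm_snd w).
have un1 : rnorm (u n.-1) <= rnorm w by exact: (dsum_rnorm_fst w).
have unN : rnorm (u (n + N)%N) <= K ^+ N * rnorm w.
  apply: le_trans (adjacent_le K1 KP zr uz N n1).
  exact: (dsum_rnorm_snd (adjacent u (n + N))).
have -> : K ^+ N * (alpha (n + N) * D r n) * rnorm w ^+ 2
  = K ^+ N * rnorm w * (alpha (n + N) * (D r n * rnorm w)) by ring.
rewrite ler_pM ?rnorm_ge0// (le_trans (opnorm_bound (a_bounded _) _))//.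
rewrite ler_wpM2l ?(ltW (alpha_gt0 _))//.
have IAu m : rnorm (IA m (u n)) <= M * (alpha m)^-1 * rnorm w.
  by rewrite (le_trans (IA_le _ _))// ler_wpM2l// divr_ge0 ?ltW//.
have r0 : 0 <= r := le_trans (absc_ge0 z) zr.
rewrite (le_trans (ler_rnormD _ _))// /D !mulrDl lerD//.
  rewrite (le_trans (ler_rnormD _ _))// lerD//.
    have bd : bounded_op (IR (n + N)%N - IR n) by exact: bounded_opB.
    rewrite (le_trans (opnorm_bound bd (u n.-1)))// ler_wpM2l//.
    exact: opnorm_ge0.
  have bd : bounded_op (IB (n + N)%N - IB n) by exact: bounded_opB.
  rewrite (le_trans (opnorm_bound bd (u n)))// ler_wpM2l//.
  exact: opnorm_ge0.
rewrite (le_trans (ler_rnormB _ _))// !rnormZc absc_conj mulrDr mulrDl.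
by rewrite lerD// -!mulrA ler_pM ?absc_ge0 ?rnorm_ge0// mulrA.
Qed.

(** By invertibility the data at [n] determine the initial data continuously; the
    constant is not uniform in [n]. *)
Let backward (r : R) n : 0 <= r -> (1 <= n)%N -> exists2 B : R, 0 <= B &
  forall z u, absc z <= r -> solves a b z u ->
    rnorm (adjacent u 1) <= B * rnorm (adjacent u n).
Proof.
move=> r0; case: n => // n _; elim: n => [|n [B B0 BP]].
  by exists 1 => // z u _ _; rewrite mul1r.
pose G := opnorm (IA n) * (r + opnorm (b n.+1) + alpha n.+1).
have G0 : 0 <= G.
  rewrite mulr_ge0 ?opnorm_ge0// !addr_ge0//; first exact: opnorm_ge0.
  exact: ltW.
exists (B * (G + 1)) => [|z u zr uz]; first by rewrite mulr_ge0 ?addr_ge0.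
rewrite (le_trans (BP _ _ zr uz))// -mulrA ler_wpM2l//.
set w := adjacent u n.+2.
have w1 : rnorm (u n.+1) <= rnorm w by exact: (dsum_rnorm_fst w).
have w2 : rnorm (u n.+2) <= rnorm w by exact: (dsum_rnorm_snd w).
rewrite (le_trans (dsum_rnorm_le _))// mulrDl mul1r lerD//=.
have -> : u n = adj (IA n) (adj (a n) (u n)).
  by apply: dot_inj => x; rewrite -(adjP (IA_bounded n)) -(adjP (a_bounded n)) aiK.
rewrite (le_trans (adj_rnorm_le _ (IA_bounded n)))// /G -mulrA.
rewrite ler_wpM2l ?opnorm_ge0//.
have -> : adj (a n) (u n) = z *: u n.+1 - b n.+1 (u n.+1) - a n.+1 (u n.+2).
  by have := uz n.+1 isT => /= <-; vector_ring.
rewrite (le_trans (ler_rnormB _ _))// mulrDl lerD//; last first.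
  by rewrite (le_trans (opnorm_bound (a_bounded _) _))// ler_wpM2l// ltW.
rewrite (le_trans (ler_rnormB _ _))// mulrDl lerD//; last first.
  by rewrite (le_trans (opnorm_bound (b_bounded _) _))// ler_wpM2l// opnorm_ge0.
by rewrite rnormZc ler_pM ?absc_ge0 ?rnorm_ge0.
Qed.

(** Along [n = k N] the form [turan] is comparable to [alpha n |adjacent u n|^2],
    and its increment over a period is a summable multiple of its value; between
    two multiples of [N] everything is controlled by the boundedness of the
    transfer operators. *)
Lemma two_sided_bound (r : R) : 0 <= r -> exists2 C : R, 0 < C &
  forall n z u, (1 <= n)%N -> absc z <= r -> solves a b z u ->
    alpha n * rnorm (adjacent u n) ^+ 2 <= C * rnorm (adjacent u 1) ^+ 2 /\
    rnorm (adjacent u 1) ^+ 2 <= C * (alpha n * rnorm (adjacent u n) ^+ 2).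
Proof.
move=> r0; have [K K1 KP] := transfer_le r0; have [L L1 LP] := alpha_shift.
have K0 : 0 <= K by exact: le_trans K1.
have L0 : 0 <= L by exact: le_trans L1.
have al0 n : 0 <= alpha n by exact: ltW.
have sq0 (x : R) : 0 <= x ^+ 2 by exact: sqr_ge0.
apply: uniform_bound => [n c d cd|n|].
- move=> h z u n1 zr uz; have [h1 h2] := h z u n1 zr uz.
  split; [apply: (le_trans h1)|apply: (le_trans h2)].
    exact: ler_wpM2r.
  by apply: ler_wpM2r => //; exact: mulr_ge0.
- case: n => [|n]; first by exists 0.
  have [B B0 BP] := backward r0 (ltn0Sn n).
  exists (alpha n.+1 * (K ^+ n) ^+ 2 + B ^+ 2 / alpha n.+1) => z u _ zr uz; split.
    rewrite mulrDl; apply: ler_wpDr; first by rewrite !mulr_ge0 ?invr_ge0 ?rnorm_ge0.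
    rewrite -mulrA ler_wpM2l//.
    rewrite -exprMn ler_pXn2r ?nnegrE ?mulr_ge0 ?exprn_ge0 ?rnorm_ge0//.
    exact: (adjacent_le K1 KP zr uz n (ltnSn 0)).
  rewrite mulrDl; apply: ler_wpDl; first by rewrite !mulr_ge0 ?exprn_ge0 ?rnorm_ge0.
  rewrite mulrA divfK ?gt_eqF// -exprMn.
  by rewrite ler_pXn2r ?nnegrE ?mulr_ge0 ?rnorm_ge0//; exact: BP zr uz.
have [c c0 [k0 cP]] := turan_coercive r; have [W WP] := D_sum r0.
pose KN := K ^+ N; pose LN := L ^+ N.
have KN0 : 0 <= KN by exact: exprn_ge0.
have LN0 : 0 <= LN by exact: exprn_ge0.
(* the increment of the form involves [u (n + N)] and the square of
   [adjacent u n], hence three factors [K ^+ N] *)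
pose E0 := KN ^+ 3 * LN / c.
have E0p : 0 < E0.
  by rewrite !divr_gt0 ?mulr_gt0 ?exprn_gt0//; apply: lt_le_trans ltr01 _.
have e0 : 0 < (2 * E0)^-1 by rewrite invr_gt0 mulr_gt0.
have [n1 n1P] := bounded_series_tail (fun n => D_ge0 n r0) WP e0.
(* from [k1] on, the relative increments add up to at most [1/2] *)
pose k1 := (n1 + k0).+1.
have k1N1 : (1 <= k1 * N)%N by rewrite muln_gt0.
have [B B0 BP] := backward r0 k1N1.
pose a' k := alpha (k * N + N).-1.
pose C1 := LN * KN ^+ 2 / c * (2 * (2 * a' k1 * KN * (K ^+ (k1 * N).-1) ^+ 2)).
pose C2 := B ^+ 2 / (c * a' k1) * (2 * (2 * KN * LN ^+ 2 * KN ^+ 2)).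
have C10 : 0 <= C1.
  by rewrite !mulr_ge0 ?invr_ge0 ?(ltW c0) ?sq0 ?al0 ?exprn_ge0.
have C20 : 0 <= C2.
  by rewrite !mulr_ge0 ?invr_ge0 ?mulr_ge0 ?(ltW c0) ?sq0 ?al0 ?exprn_ge0.
exists (C1 + C2), (k1 * N)%N => n nk z u npos zr uz.
pose v k := adjacent u (k * N); pose S k := s * turan a N u (k * N).
have k1N k : (k1 <= k)%N -> (1 <= k * N)%N.
  by move=> kk; rewrite muln_gt0 N_ge1 (leq_trans _ kk).
have k0k k : (k1 <= k)%N -> (k0 <= k)%N.
  by move=> kk; rewrite (leq_trans _ kk)// /k1 -addSn leq_addl.
have Slow k : (k1 <= k)%N -> c * a' k * rnorm (v k) ^+ 2 <= S k.
  move=> kk; have := cP k z (v k) (k0k _ kk) zr.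
  by rewrite step_solution//; exact: leq_trans kk.
have Sup k : (k1 <= k)%N -> S k <= 2 * a' k * KN * rnorm (v k) ^+ 2.
  move=> kk; rewrite (le_trans (ler_norm _))// normrM s_sign mul1r.
  rewrite (le_trans (commform_le _ _ _))// expr2 !mulrA ler_wpM2r ?rnorm_ge0//.
  rewrite -!mulrA ler_wpM2l// /a' ler_wpM2l//.
  exact: (adjacent_le K1 KP zr uz N (k1N _ kk)).
pose eps k := E0 * \sum_(i < N) D r (k * N + i)%N.
have Sdiff k : (k1 <= k)%N -> `|S k.+1 - S k| <= eps k * S k.
  move=> kk; rewrite -mulrBr normrM s_sign mul1r.
  have -> : turan a N u (k.+1 * N) - turan a N u (k * N) =
      \sum_(i < N) (turan a N u (k * N + i).+1 - turan a N u (k * N + i)).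
    rewrite -(big_mkord xpredT
      (fun i => turan a N u (k * N + i).+1 - turan a N u (k * N + i))).
    under eq_bigr => i _ do rewrite -addnS.
    by rewrite telescope_sumr// addn0 mulSn addnC.
  rewrite (le_trans (ler_norm_sum _ _ _))// /eps mulrAC mulr_sumr ler_sum// => i _.
  have kN1 := k1N _ kk.
  have ki1 : (1 <= k * N + i)%N by rewrite (leq_trans kN1) ?leq_addr.
  rewrite (le_trans (turan_diff K1 KP zr uz ki1))//.
  have iN : (i <= N)%N by exact: ltnW.
  have al : alpha (k * N + i + N) <= LN * a' k.
    rewrite (block_shift k i N_ge1).
    by have [] := LP (k * N + N).-1 i.+1 N (ltn_ord i).
  have vi : rnorm (adjacent u (k * N + i)) ^+ 2 <= KN ^+ 2 * rnorm (v k) ^+ 2.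
    rewrite -exprMn ler_pXn2r ?nnegrE ?mulr_ge0 ?rnorm_ge0//.
    exact: (adjacent_le_max K1 KP zr uz kN1 iN).
  have Di := D_ge0 (k * N + i) r0.
  have h : KN * (alpha (k * N + i + N) * D r (k * N + i))
      * rnorm (adjacent u (k * N + i)) ^+ 2
     <= KN * (LN * a' k * D r (k * N + i)) * (KN ^+ 2 * rnorm (v k) ^+ 2).
    by rewrite ler_pM ?mulr_ge0 ?rnorm_ge0// ler_wpM2l// ler_wpM2r.
  rewrite (le_trans h)//.
  have -> : KN * (LN * a' k * D r (k * N + i)) * (KN ^+ 2 * rnorm (v k) ^+ 2)
     = E0 * (c * a' k * rnorm (v k) ^+ 2) * D r (k * N + i).
    by rewrite /E0; field; rewrite gt_eqF.
  by rewrite ler_wpM2r// ler_wpM2l ?Slow// ltW.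
have S0 k : (k1 <= k)%N -> 0 <= S k.
  by move=> kk; rewrite (le_trans _ (Slow _ kk))// !mulr_ge0 ?rnorm_ge0 ?(ltW c0) ?al0.
have eps0 k : 0 <= eps k.
  by rewrite mulr_ge0 ?(ltW E0p)// sumr_ge0// => i _; exact: D_ge0.
have epsV m : \sum_(k1 <= k < m) eps k <= 2^-1.
  rewrite -mulr_sumr sum_nat_blocks.
  have /(ler_wpM2l (ltW E0p)) : \sum_(k1 * N <= n < m * N) D r n <= (2 * E0)^-1.
    have [km|mk] := leqP (k1 * N) (m * N); last by rewrite (big_geq (ltnW mk)) ltW.
    have nk1 : (n1 <= k1 * N)%N.
      by rewrite (leq_trans _ (leq_pmulr _ N_ge1))// /k1 -addnS leq_addr.
    rewrite (le_trans _ (n1P (m * N)%N))// [leRHS](big_cat_nat nk1 km)/= lerDr.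
    by rewrite sumr_ge0// => i _; exact: D_ge0.
  by rewrite invfM mulrCA mulfV ?mulr1 ?gt_eqF.
have sv := slowly_varying S0 eps0 Sdiff epsV.
pose k := (n %/ N)%N; pose j := (n %% N)%N.
have nE : n = (k * N + j)%N by exact: divn_eq.
have jN : (j < N)%N by rewrite ltn_mod.
have kk1 : (k1 <= k)%N by rewrite leq_divRL.
have ac0 q : 0 < c * a' q by rewrite mulr_gt0// alpha_gt0.
have SA q : (k1 <= q)%N -> a' q * rnorm (v q) ^+ 2 <= S q / c.
  by move=> qq; rewrite ler_pdivlMr// mulrC mulrA Slow.
split.
- apply: (@le_trans _ _ (C1 * rnorm (adjacent u 1) ^+ 2)); last first.
    by rewrite ler_wpM2r// lerDl.
  have an : alpha n <= LN * a' k.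
    have jm : (N.-1 - j <= N)%N by rewrite (leq_trans (leq_subr _ _)) ?leq_pred.
    by have [_] := LP n _ N jm; rewrite {2}nE block_last.
  have vn : rnorm (adjacent u n) ^+ 2 <= KN ^+ 2 * rnorm (v k) ^+ 2.
    rewrite -exprMn ler_pXn2r ?nnegrE ?mulr_ge0 ?rnorm_ge0// nE.
    exact: (adjacent_le_max K1 KP zr uz (k1N _ kk1) (ltnW jN)).
  have v1 : rnorm (v k1) ^+ 2 <= (K ^+ (k1 * N).-1) ^+ 2 * rnorm (adjacent u 1) ^+ 2.
    rewrite -exprMn ler_pXn2r ?nnegrE ?mulr_ge0 ?exprn_ge0 ?rnorm_ge0//.
    have := adjacent_le K1 KP zr uz (k1 * N).-1 (ltnSn 0).
    by rewrite add1n prednK// k1N.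
  rewrite (le_trans (ler_pM _ _ an vn))//.
  have -> : LN * a' k * (KN ^+ 2 * rnorm (v k) ^+ 2) =
    LN * KN ^+ 2 * (a' k * rnorm (v k) ^+ 2) by ring.
  have -> : C1 * rnorm (adjacent u 1) ^+ 2 = LN * KN ^+ 2 * (2 * (2 * a' k1 * KN
      * ((K ^+ (k1 * N).-1) ^+ 2 * rnorm (adjacent u 1) ^+ 2)) / c).
    by rewrite /C1; ring.
  rewrite ler_wpM2l ?mulr_ge0// (le_trans (SA _ kk1))//.
  rewrite ler_wpM2r ?invr_ge0 ?(ltW c0)// (le_trans (sv _ kk1).1)// ler_wpM2l//.
  by rewrite (le_trans (Sup _ (leqnn _)))// ler_wpM2l ?mulr_ge0 ?al0.
- apply: (@le_trans _ _ (C2 * (alpha n * rnorm (adjacent u n) ^+ 2))); last first.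
    by rewrite ler_wpM2r ?mulr_ge0 ?rnorm_ge0// lerDr.
  have kk2 : (k1 <= k.+1)%N by exact: leqW.
  have an : a' k.+1 <= LN ^+ 2 * alpha n.
    have jm : (N + (N.-1 - j) <= N * 2)%N.
      by rewrite muln2 -addnn leq_add2l (leq_trans (leq_subr _ _)) ?leq_pred.
    by rewrite -exprM; have [+ _] := LP n _ _ jm; rewrite {1}nE block_next_last.
  have vn : rnorm (v k.+1) ^+ 2 <= KN ^+ 2 * rnorm (adjacent u n) ^+ 2.
    rewrite -exprMn ler_pXn2r ?nnegrE ?mulr_ge0 ?rnorm_ge0//.
    have := adjacent_le_max K1 KP zr uz npos (leq_subr j N).
    by rewrite {1}nE block_next.
  have v1 : rnorm (adjacent u 1) ^+ 2 <= B ^+ 2 * rnorm (v k1) ^+ 2.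
    by rewrite -exprMn ler_pXn2r ?nnegrE ?mulr_ge0 ?rnorm_ge0//; exact: BP zr uz.
  rewrite (le_trans v1)// /C2 -mulrA -[B ^+ 2 / _ * _]mulrA ler_wpM2l//.
  rewrite mulrC ler_pdivlMr// mulrC (le_trans (Slow _ (leqnn _)))//.
  rewrite (le_trans (sv _ kk2).2)// -mulrA ler_wpM2l//.
  rewrite (le_trans (Sup _ kk2))//.
  have -> : 2 * KN * LN ^+ 2 * KN ^+ 2 * (alpha n * rnorm (adjacent u n) ^+ 2)
   = 2 * (LN ^+ 2 * alpha n) * KN * (KN ^+ 2 * rnorm (adjacent u n) ^+ 2) by ring.
  by rewrite ler_pM ?mulr_ge0 ?rnorm_ge0 ?al0// ler_wpM2r// ler_wpM2l.
Qed.

End TwoSidedBound.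

(** * Products of block operators *)

Section PerturbedProducts.
Variables (R : realType) (V : normedModType R[i]).

Lemma op_prod_le (X : nat -> V -> V) (K : R) n v : 0 <= K ->
  (forall i w, (i < n)%N -> rnorm (X i w) <= K * rnorm w) ->
  rnorm (op_prod X n v) <= K ^+ n * rnorm v.
Proof.
move=> K0; elim: n => [|n IHn] XK; first by rewrite expr0 mul1r.
rewrite /= (le_trans (XK _ _ (ltnSn n)))// exprS -mulrA ler_wpM2l// IHn// => i w.
by move=> /ltnW; exact: XK.
Qed.

(** The products are compared one factor at a time; the error of each factor is
    amplified by the factors applied after it. *)
Lemma op_prod_close (X Y : nat -> V -> V) (K e : R) n v :
  1 <= K -> 0 <= e -> (forall i, bounded_op (Y i)) ->
  (forall i w, (i < n)%N -> rnorm (X i w) <= K * rnorm w) ->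
  (forall i w, (i < n)%N -> rnorm (Y i w) <= K * rnorm w) ->
  (forall i w, (i < n)%N -> rnorm (X i w - Y i w) <= e * rnorm w) ->
  rnorm (op_prod X n v - op_prod Y n v) <= n%:R * K ^+ n * e * rnorm v.
Proof.
move=> K1 e0 bY; have K0 : 0 <= K by exact: le_trans K1.
elim: n => [|n IHn] XK YK XY.
  by rewrite /= subrr !mul0r /rnorm normr0.
have up (P : nat -> Prop) : (forall i, (i < n.+1)%N -> P i) ->
    forall i, (i < n)%N -> P i by move=> h i /ltnW; exact: h.
have XK' i w : (i < n)%N -> rnorm (X i w) <= K * rnorm w by move=> /ltnW/XK.
have {}IHn := IHn XK' (fun i w h => YK i w (ltnW h)) (fun i w h => XY i w (ltnW h)).
have Xn := op_prod_le v K0 XK'.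
rewrite /= -[X n _](subrK (Y n (op_prod X n v))) -addrA -(opB (bY n)).
rewrite (le_trans (ler_rnormD _ _))//.
have h1 := XY n (op_prod X n v) (ltnSn n).
have h2 := YK n (op_prod X n v - op_prod Y n v) (ltnSn n).
have {}h1 := le_trans h1 (ler_wpM2l e0 Xn).
have {}h2 := le_trans h2 (ler_wpM2l K0 IHn).
rewrite (le_trans (lerD h1 h2))// -natr1.
have Kn0 : 0 <= K ^+ n by exact: exprn_ge0.
have v0 := rnorm_ge0 v.
have : e * (K ^+ n * rnorm v) <= e * (K ^+ n.+1 * rnorm v).
  by rewrite ler_wpM2l// ler_wpM2r// exprS ler_peMl.
move=> h; rewrite (le_trans (lerD h (lexx _)))// exprS.
by rewrite le_eqVlt; apply/orP; left; apply/eqP; ring.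
Qed.

End PerturbedProducts.

Section BlockOperators.
Variables (R : realType) (H : preHilbertType R).
Implicit Types X Y : H -> H.

Lemma bounded_op0 : bounded_op (0 : H -> H).
Proof.
split=> [c x y|]; first by change ((0 : H) = c *: 0 + 0); rewrite scaler0 addr0.
by exists 0 => x; change (rnorm (0 : H) <= 0 * rnorm x); rewrite rnorm0 mul0r.
Qed.

Lemma bounded_op_id : bounded_op (idfun : H -> H).
Proof. by split=> [//|]; exists 1 => x; rewrite mul1r. Qed.

Lemma bounded_opN X : bounded_op X -> bounded_op (- X).
Proof.
by move=> bX; rewrite -[- X]add0r; exact: bounded_opB bounded_op0 bX.
Qed.

Lemma bounded_op_block X11 X12 X21 X22 :
  bounded_op X11 -> bounded_op X12 -> bounded_op X21 -> bounded_op X22 ->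
  bounded_op (op_block X11 X12 X21 X22).
Proof.
move=> b11 b12 b21 b22; split=> [c x y|].
  rewrite /op_block /=; congr (_, _).
  - by rewrite !(opD b11, opD b12) (opZ b11) (opZ b12); vector_ring.
  - by rewrite !(opD b21, opD b22) (opZ b21) (opZ b22); vector_ring.
exists (opnorm X11 + opnorm X12 + (opnorm X21 + opnorm X22)) => v.
have v1 := dsum_rnorm_fst v; have v2 := dsum_rnorm_snd v.
rewrite (le_trans (dsum_rnorm_le _))// mulrDl lerD//= mulrDl;
  rewrite (le_trans (ler_rnormD _ _))// lerD//;
  by rewrite (le_trans (opnorm_bound _ _))// ler_wpM2l// opnorm_ge0.
Qed.

Lemma has_adj_comp (V : preHilbertType R) (X X' Y Y' : V -> V) :
  has_adj X Y -> has_adj X' Y' -> has_adj (X \o X') (Y' \o Y).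
Proof. by move=> XY XY' x y /=; rewrite XY XY'. Qed.

Lemma has_adj_op_prod (V : preHilbertType R) (X : nat -> V -> V) n :
  (forall i, exists Y : V -> V, has_adj (X i) Y) ->
  exists Y : V -> V, has_adj (op_prod X n) Y.
Proof.
move=> aX; elim: n => [|n [Y YP]]; first by exists idfun.
by have [Z ZP] := aX n; exists (Y \o Z); exact: has_adj_comp.
Qed.

Lemma has_adj_block X11 X12 X21 X22 Y11 Y12 Y21 Y22 :
  has_adj X11 Y11 -> has_adj X12 Y12 -> has_adj X21 Y21 -> has_adj X22 Y22 ->
  has_adj (op_block X11 X12 X21 X22) (op_block Y11 Y21 Y12 Y22).
Proof.
move=> a11 a12 a21 a22 x y; rewrite !dsum_dotE /op_block /=.
by rewrite !(dotDl, dotDr) a11 a12 a21 a22 addrACA.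
Qed.

Lemma re_op_dot (V : preHilbertType R) (X Y : V -> V) v : has_adj X Y ->
  complex.Re (dotp (re_op X v) v) = rdot (X v) v.
Proof.
move=> XY; rewrite /re_op (has_adjP XY) !fctE dotZl dotDl (has_adjC XY).
rewrite [dotp v _]dotC /rdot.
have -> : 2^-1 = (2^-1 : R)%:C%C :> R[i] by rewrite fmorphV rmorph_nat.
rewrite Re_realM ReD Re_conj; lra.
Qed.

End BlockOperators.

(** * Consequences of the convergence along a period *)

Section Periodic.
Variable N : nat.
Hypothesis N_ge1 : (1 <= N)%N.

Lemma periodic_shift (A : Type) (f : nat -> A) k i :
  (forall n, f (n + N)%N = f n) -> f (k * N + i)%N = f i.
Proof.
move=> fN; elim: k => [|k IHk]; first by rewrite mul0n.
by rewrite mulSn -addnA addnC fN.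
Qed.

Lemma periodic_bounded (R : realType) (f : nat -> R) :
  (forall n, f (n + N)%N = f n) -> exists2 M : R, 0 < M & forall n, f n <= M.
Proof.
move=> fN; exists (1 + \sum_(i < N) `|f i|); first by rewrite ltr_pwDl// sumr_ge0.
move=> n; rewrite (divn_eq n N) periodic_shift//.
have iN : (n %% N < N)%N by rewrite ltn_mod.
rewrite (le_trans (ler_norm _))// (bigD1 (Ordinal iN))//= addrCA lerDl.
by rewrite addr_ge0// sumr_ge0.
Qed.

End Periodic.

Section Hypotheses.
Variables (R : realType) (H : hilbertType R) (a b : nat -> H -> H) (N : nat).
Variables (T Q Rl C : nat -> H -> H).
Hypothesis H_neq0 : exists x : H, x != 0.
Hypothesis a_bounded : forall n, bounded_op (a n).
Hypothesis a_inv : forall n, boundedly_invertible (a n).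
Hypothesis b_bounded : forall n, bounded_op (b n).
Hypothesis b_sa : forall n, self_adjoint_op (b n).
Hypothesis N_ge1 : (1 <= N)%N.
Hypothesis variation_lty :
    (op_variation N 0 (fun n => invop (a n)) +
     op_variation N 0 (fun n => invop (a n) \o b n) +
     op_variation N 1 (fun n => invop (a n) \o adj (a n.-1)) < +oo)%E.
Hypothesis T_bounded : forall n, bounded_op (T n).
Hypothesis Q_bounded : forall n, bounded_op (Q n).
Hypothesis Rl_bounded : forall n, bounded_op (Rl n).
Hypothesis C_bounded : forall n, bounded_op (C n).
Hypothesis T_periodic : forall n, T (n + N)%N = T n.
Hypothesis Q_periodic : forall n, Q (n + N)%N = Q n.
Hypothesis Rl_periodic : forall n, Rl (n + N)%N = Rl n.
Hypothesis C_periodic : forall n, C (n + N)%N = C n.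
Hypothesis C_inv : forall n, boundedly_invertible (C n).
Hypothesis lim_T : opnorm (invop (a n) - T n) @[n --> \oo] --> (0 : R).
Hypothesis lim_Q : opnorm (invop (a n) \o b n - Q n) @[n --> \oo] --> (0 : R).
Hypothesis lim_Rl :
  opnorm (invop (a n) \o adj (a n.-1) - Rl n) @[n --> \oo] --> (0 : R).
Hypothesis lim_C :
  opnorm (((opnorm (a n))^-1)%:C%C *: a n - C n) @[n --> \oo] --> (0 : R).
Hypothesis Lambda_neq0 : Lambda N T Q Rl C !=set0.
Hypothesis not_carleman : ~ carleman a.

Local Notation alpha n := (opnorm (a n)).
Local Notation IA n := (invop (a n)).
Local Notation IB n := (invop (a n) \o b n).
Local Notation IR n := (invop (a n) \o adj (a n.-1)).
Local Notation step z k := (op_prod (fun i => transfer a b z (k * N + i)) N).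

Let IA_bounded n : bounded_op (IA n).
Proof. by case: (invopP (a_inv n)). Qed.

Let aiK n : cancel (IA n) (a n).
Proof. by case: (invopP (a_inv n)). Qed.

Let IB_bounded n : bounded_op (IB n).
Proof. exact: bounded_op_comp. Qed.

Let IR_bounded n : bounded_op (IR n).
Proof. by apply: bounded_op_comp => //; exact: adj_bounded. Qed.

Let alpha_gt0 n : 0 < alpha n.
Proof. exact: opnorm_invertible_gt0. Qed.

(** Eventually the operators are close to one of the finitely many values of the
    periodic limit. *)
Lemma limit_bounded (X L : nat -> H -> H) :
  (forall n, bounded_op (X n)) -> (forall n, bounded_op (L n)) ->
  (forall n, L (n + N)%N = L n) -> opnorm (X n - L n) @[n --> \oo] --> (0 : R) ->
  exists2 M : R, 0 < M & forall n x, rnorm (X n x) <= M * rnorm x.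
Proof.
move=> bX bL LN XL.
have [q q0 qP] : exists2 q : R, 0 < q & forall n, opnorm (L n) <= q.
  by apply: (periodic_bounded N_ge1) => n; rewrite LN.
have [n0 n0P] := cvg0_eventually XL ltr01.
have [n n0n|M M0 MP] := @eventually_bounded _ (fun n => opnorm (X n)) (1 + q) n0.
  apply: opnorm_le => [|x]; first by rewrite addr_ge0// ltW.
  rewrite -[X n x](subrK (L n x)) mulrDl (le_trans (ler_rnormD _ _))// lerD//.
    rewrite (le_trans (opnorm_bound (bounded_opB (bX n) (bL n)) x))//.
    by rewrite ler_wpM2r ?rnorm_ge0// (le_trans (ler_norm _))// ltW// n0P.
  by rewrite (le_trans (opnorm_bound (bL n) x))// ler_wpM2r ?rnorm_ge0.
exists M => // n x; rewrite (le_trans (opnorm_bound (bX n) x))//.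
by rewrite ler_wpM2r ?rnorm_ge0.
Qed.

Lemma IB_uniform :
  exists2 M : R, 0 < M & forall n x, rnorm (IB n x) <= M * rnorm x.
Proof. exact: limit_bounded lim_Q. Qed.

Lemma IR_uniform :
  exists2 M : R, 0 < M & forall n x, rnorm (IR n x) <= M * rnorm x.
Proof. exact: limit_bounded lim_Rl. Qed.

(** Because the limits [C n] of the normalised [a n] are invertible, [a n]
    expands all vectors at a rate comparable with its norm. *)
Lemma IA_uniform :
  exists2 M : R, 0 < M & forall n x, rnorm (IA n x) <= M / alpha n * rnorm x.
Proof.
have [q q0 qP] : exists2 q : R, 0 < q & forall n, opnorm (invop (C n)) <= q.
  by apply: (periodic_bounded N_ge1) => n; rewrite C_periodic.
have Cx n x : rnorm x <= q * rnorm (C n x).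
  have [bi CK _] := invopP (C_inv n).
  rewrite -{1}[x]CK (le_trans (opnorm_bound bi _))// ler_wpM2r ?rnorm_ge0//.
have e0 : 0 < (2 * q)^-1 by rewrite invr_gt0 mulr_gt0.
have [n0 n0P] := cvg0_eventually lim_C e0.
have [n n0n|M M0 MP] :=
    @eventually_bounded _ (fun n => opnorm (IA n) * alpha n) (2 * q) n0.
  rewrite -ler_pdivlMr//; apply: opnorm_le => [|y].
    by rewrite divr_ge0 ?mulr_ge0// ltW.
  set x := IA n y; have -> : y = a n x by rewrite /x aiK.
  have al0 : 0 <= (alpha n)^-1 by rewrite invr_ge0 ltW.
  have dC : rnorm (C n x) <= (alpha n)^-1 * rnorm (a n x) + (2 * q)^-1 * rnorm x.
    rewrite -(rnormZr _ al0) -[C n x](subKr ((alpha n)^-1%:C%C *: a n x)).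
    rewrite (le_trans (ler_rnormB _ _))// lerD//.
    have bd : bounded_op ((alpha n)^-1%:C%C *: a n - C n).
      by apply: bounded_opB => //; exact: bounded_opZ.
    rewrite (le_trans (opnorm_bound bd x))// ler_wpM2r ?rnorm_ge0//.
    by rewrite (le_trans (ler_norm _))// ltW// n0P.
  have := le_trans (Cx n x) (ler_wpM2l (ltW q0) dC).
  rewrite mulrDr; have -> : q * ((2 * q)^-1 * rnorm x) = rnorm x / 2.
    by field; rewrite gt_eqF.
  rewrite -!mulrA; move: (q * _) (rnorm x) => p t; lra.
exists M => // n x; rewrite (le_trans (opnorm_bound (IA_bounded n) x))//.
by rewrite ler_wpM2r ?rnorm_ge0// ler_pdivlMr.
Qed.

Lemma alpha_inv_sum : exists V : R, forall m, \sum_(0 <= n < m) (alpha n)^-1 <= V.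
Proof.
apply: nneseries_bounded => [n|]; first by rewrite invr_ge0 ltW.
by rewrite ltey; apply/eqP.
Qed.

Let variation_ge0 n0 (X : nat -> H -> H) : (forall n, bounded_op (X n)) ->
  (0 <= op_variation N n0 X)%E.
Proof.
move=> bX; apply: nneseries_ge0 => n _ _; rewrite lee_fin opnorm_ge0//.
exact: bounded_opB.
Qed.

Lemma IB_variation : exists V : R,
  forall m, \sum_(0 <= n < m) opnorm (IB (n + N)%N - IB n) <= V.
Proof.
apply: nneseries_bounded => [n|].
  by apply: opnorm_ge0; exact: bounded_opB.
apply: le_lt_trans variation_lty; rewrite -addeA addeCA leeDl// adde_ge0//.
  exact: variation_ge0.
exact: variation_ge0.
Qed.

Lemma IR_variation : exists V : R,
  forall m, \sum_(1 <= n < m) opnorm (IR (n + N)%N - IR n) <= V.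
Proof.
apply: nneseries_bounded => [n|].
  by apply: opnorm_ge0; exact: bounded_opB.
apply: le_lt_trans variation_lty; rewrite leeDr// adde_ge0//.
  exact: variation_ge0.
exact: variation_ge0.
Qed.

Lemma alpha_inv_small (e : R) : 0 < e ->
  exists n0, forall n, (n0 <= n)%N -> (alpha n)^-1 <= e.
Proof.
move=> e0; have [V VP] := alpha_inv_sum.
have al0 n : 0 <= (alpha n)^-1 by rewrite invr_ge0 ltW.
have [n0 n0P] := bounded_series_tail al0 VP e0.
exists n0 => n n0n; rewrite (le_trans _ (n0P n.+1))// big_nat_recr//= lerDr.
by rewrite sumr_ge0.
Qed.

(** The inverse of [a n] is at most of the order of the [n]-th term of the
    convergent Carleman series, hence tends to zero. *)
Lemma T_eq0 i x : T i x = 0.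
Proof.
apply: rnorm0_eq0; apply/eqP; rewrite eq_le rnorm_ge0 andbT.
apply/ler_addgt0Pl => e e0; rewrite addr0.
have [M M0 MP] := IA_uniform.
have x1 : 0 < rnorm x + 1 by rewrite ltr_wpDl ?rnorm_ge0.
have e1 : 0 < e / 2 / (rnorm x + 1) by rewrite !divr_gt0.
have e2 : 0 < e / 2 / (rnorm x + 1) / M by rewrite !divr_gt0.
have [n1 n1P] := cvg0_eventually lim_T e1; have [n2 n2P] := alpha_inv_small e2.
pose n := ((n1 + n2) * N + i)%N.
have nn1 : (n1 <= n)%N.
  by rewrite /n mulnDl -addnA (leq_trans (leq_pmulr _ N_ge1))// leq_addr.
have nn2 : (n2 <= n)%N.
  rewrite /n mulnDl -addnA addnCA (leq_trans (leq_pmulr _ N_ge1))//.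
  by rewrite leq_addr.
rewrite -(periodic_shift (n1 + n2) i T_periodic) -/n.
rewrite -[T n x](subKr (IA n x)) [leRHS]splitr.
rewrite (le_trans (ler_rnormB _ _))// lerD//.
  rewrite (le_trans (MP _ _))//.
  have h := n2P _ nn2.
  have : M / alpha n * rnorm x <= M * (e / 2 / (rnorm x + 1) / M) * (rnorm x + 1).
    rewrite ler_pM ?mulr_ge0 ?invr_ge0 ?rnorm_ge0 ?(ltW M0) ?(ltW (alpha_gt0 _))//.
      by rewrite ler_wpM2l// ltW.
    by rewrite lerDl.
  move=> /le_trans; apply; rewrite mulrCA mulfV ?gt_eqF// mulr1 divfK//.
  by rewrite gt_eqF.
rewrite (le_trans (opnorm_bound (bounded_opB (IA_bounded n) (T_bounded n)) x))//.
have h := ltW (n1P _ nn1).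
rewrite (@le_trans _ _ (e / 2 / (rnorm x + 1) * (rnorm x + 1)))//; last first.
  by rewrite divfK// gt_eqF.
rewrite ler_pM ?rnorm_ge0 ?lerDl//.
  by apply: opnorm_ge0; exact: bounded_opB.
by rewrite (le_trans (ler_norm _)).
Qed.

Local Notation limit_transfer lambda := (fun i =>
  op_block 0 idfun (- Rl i) (lambda%:C%C *: T i - Q i)).

Let limit_transfer_bounded (l : R) i : bounded_op (limit_transfer l i).
Proof.
apply: bounded_op_block.
- exact: bounded_op0.
- exact: bounded_op_id.
- exact: bounded_opN.
- by apply: bounded_opB => //; exact: bounded_opZ.
Qed.

(** The real part of an operator has the same real quadratic form as the operator
    itself, provided that the operator has an adjoint; here the adjoint is built
    blockwise. The sign [s] treats the positive and the negative case at once. *)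
Lemma limit_form_coercive : exists (l s c : R), [/\ `|s| = 1, 0 < c &
  forall v : dsum H, c * rnorm v ^+ 2
    <= s * commform (C N.-1) (op_prod (limit_transfer l) N v) v].
Proof.
have [l lL] := Lambda_neq0; exists l.
set E := op_block 0 (- C N.-1) (adj (C N.-1)) 0.
set P := op_prod (limit_transfer l) N.
have adj0 : has_adj (0 : H -> H) 0.
  by move=> x y; change (dotp (0 : H) y = dotp x 0 :> R[i]); rewrite dot0l dot0r.
have adjN (X Y : H -> H) : has_adj X Y -> has_adj (- X) (- Y).
  by move=> h x y; rewrite !fctE dotNl dotNr h.
have adjB (X X' Y Y' : H -> H) :
    has_adj X Y -> has_adj X' Y' -> has_adj (X - X') (Y - Y').
  by move=> h h' x y; rewrite !fctE dotBl dotBr h h'.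
have [Y EP] : exists Y, has_adj (E \o P) Y.
  have [i|Z PZ] := @has_adj_op_prod _ (dsum H) (limit_transfer l) N.
    eexists; apply: has_adj_block; first exact: adj0.
    - by move=> x y; reflexivity.
    - by apply: adjN; exact: adjP.
    - by apply: adjB; [apply: adjP; exact: bounded_opZ|exact: adjP].
  eexists; apply: has_adj_comp PZ; apply: has_adj_block; first exact: adj0.
  - by apply: adjN; exact: adjP.
  - by apply: has_adjC; exact: adjP.
  - exact: adj0.
have form v : complex.Re (dotp (calF N T Q Rl C l v) v) = commform (C N.-1) (P v) v.
  rewrite (re_op_dot v EP) /= /rdot dsum_dotE /E /op_block /=.
  rewrite -/(rdot _ _) ReD /commform.
  change (rdot (0 + - C N.-1 (P v).2) v.1 + rdot (adj (C N.-1) (P v).1 + 0) v.2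
    = rdot (P v).1 (C N.-1 v.2) - rdot (C N.-1 (P v).2) v.1).
  rewrite add0r addr0 rdotNl addrC; congr (_ - _).
  by rewrite /rdot -(has_adjC (adjP (C_bounded _))).
case: lL => -[c c0 cP].
  exists 1, c; split=> [|//|v]; first by rewrite normr1.
  have := cP v; rewrite lecE => /andP[_].
  by rewrite dotpp -rmorphM/= form mul1r.
exists (-1), c; split=> [|//|v]; first by rewrite normrN1.
have := cP v; rewrite lecE => /andP[_].
by rewrite dotpp -rmorphM/= !fctE dotNl ReN form mulN1r.
Qed.

(** Uniformity in [z] comes from the factor [invop (a n)] in front of [z], which
    tends to zero. *)
Lemma transfer_close (l r e : R) : 0 <= r -> 0 < e ->
  exists n0, forall n z v, (n0 <= n)%N -> absc z <= r ->
    rnorm (transfer a b z n v - limit_transfer l n v) <= e * rnorm v.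
Proof.
move=> r0 e0; have e3 : 0 < e / 3 by rewrite divr_gt0.
have [M M0 MP] := IA_uniform.
have rM : 0 < r * M + 1 by rewrite ltr_wpDl// mulr_ge0// ltW.
have e4 : 0 < e / 3 / (r * M + 1) by rewrite divr_gt0.
have [n1 n1P] := cvg0_eventually lim_Q e3.
have [n2 n2P] := cvg0_eventually lim_Rl e3.
have [n3 n3P] := alpha_inv_small e4.
exists (n1 + n2 + n3)%N => n z v nn zr.
have v1 := dsum_rnorm_fst v; have v2 := dsum_rnorm_snd v.
have -> : transfer a b z n v - limit_transfer l n v = (0,
    z *: IA n v.2 - (IB n - Q n) v.2 - (IR n - Rl n) v.1).
  rewrite transferE /op_block !fctE T_eq0 scaler0.
  change ((v.2 - (0 + v.2), z *: IA n v.2 - IA n (b n v.2) - IA n (adj (a n.-1) v.1)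
    - (- Rl n v.1 + (0 - Q n v.2))) = (0 : H, z *: IA n v.2 - (IA n (b n v.2) - Q n v.2)
    - (IA n (adj (a n.-1) v.1) - Rl n v.1))).
  by congr (_, _); vector_ring.
rewrite (le_trans (dsum_rnorm_le _))//= rnorm0 add0r.
have -> : e * rnorm v = e / 3 * rnorm v + e / 3 * rnorm v + e / 3 * rnorm v.
  by field.
rewrite (le_trans (ler_rnormB _ _))// lerD//; last first.
  rewrite (le_trans (opnorm_bound (bounded_opB (IR_bounded n) (Rl_bounded n)) _))//.
  rewrite ler_pM ?rnorm_ge0//.
    by apply: opnorm_ge0; exact: bounded_opB.
  rewrite (le_trans (ler_norm _))// ltW// n2P//.
  by rewrite (leq_trans _ nn)// addnAC leq_addl.
rewrite (le_trans (ler_rnormB _ _))// lerD//; last first.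
  rewrite (le_trans (opnorm_bound (bounded_opB (IB_bounded n) (Q_bounded n)) _))//.
  rewrite ler_pM ?rnorm_ge0//.
    by apply: opnorm_ge0; exact: bounded_opB.
  rewrite (le_trans (ler_norm _))// ltW// n1P//.
  by rewrite (leq_trans _ nn)// -addnA leq_addr.
have an : (alpha n)^-1 <= e / 3 / (r * M + 1).
  by rewrite n3P// (leq_trans _ nn)// leq_addl.
have al0 : 0 <= (alpha n)^-1 by rewrite invr_ge0 ltW.
rewrite rnormZc (@le_trans _ _ (r * (M / alpha n * rnorm v)))//.
  rewrite ler_pM ?absc_ge0 ?rnorm_ge0// (le_trans (MP _ _))// ler_wpM2l//.
  by rewrite mulr_ge0// ltW.
rewrite !mulrA ler_wpM2r ?rnorm_ge0//.
rewrite (@le_trans _ _ ((r * M + 1) * (e / 3 / (r * M + 1))))//.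
  by rewrite ler_pM ?lerDl ?mulr_ge0// ltW.
by rewrite mulrC divfK// gt_eqF.
Qed.

(** For large [k] the period product starting at [k N] is close to the product of
    the limit operators, so coercivity of the limit form is inherited. *)
Lemma turan_coercive : exists2 s : R, `|s| = 1 & forall r : R,
  exists2 c : R, 0 < c & exists k0, forall k z (v : dsum H), (k0 <= k)%N ->
    absc z <= r -> c * alpha (k * N + N).-1 * rnorm v ^+ 2
      <= s * commform (a (k * N + N).-1) (step z k v) v.
Proof.
have [l [s [c [s1 c0 cP]]]] := limit_form_coercive; exists s => // r.
exists (c / 2); first by rewrite divr_gt0.
have [Kl Kl0 KlP] : exists2 M : R, 0 < M &
    forall n, opnorm (limit_transfer l n) <= M.
  by apply: (periodic_bounded N_ge1) => n; rewrite T_periodic Q_periodic Rl_periodic.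
pose q := opnorm (C N.-1); have q0 : 0 <= q by exact: opnorm_ge0.
pose K := Kl + 1; have K1 : 1 <= K by rewrite lerDr ltW.
have K0 : 0 <= K by exact: le_trans K1.
(* [e * G] bounds the error made by passing to the limits: [1] accounts for the
   normalised [a], [q * N%:R] for the product of [N] transfer operators *)
pose G := 2 * K ^+ N * (1 + q * N%:R).
have G0 : 0 < G.
  rewrite mulr_gt0 ?mulr_gt0 ?exprn_gt0 ?(lt_le_trans ltr01 K1)//.
  by rewrite ltr_pwDl// mulr_ge0.
pose e := Num.min 1 (c / (2 * G)).
have e0 : 0 < e by rewrite /e lt_min ltr01 divr_gt0// mulr_gt0.
have e1 : e <= 1 by rewrite /e ge_min lexx.
have eG : e * G <= c / 2.
  rewrite -ler_pdivlMr// (le_trans (_ : e <= c / (2 * G)))//.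
    by rewrite /e ge_min lexx orbT.
  by rewrite invfM mulrA.
have [n1 n1P] := transfer_close l (normr_ge0 r) e0.
have [n2 n2P] := cvg0_eventually lim_C e0.
exists (n1 + n2)%N => k z v kk zr.
have zr' : absc z <= `|r| := le_trans zr (ler_norm r).
have big m i : (m <= n1 + n2)%N -> (m <= k * N + i)%N.
  move=> mn; rewrite (leq_trans mn)// (leq_trans kk)//.
  by rewrite (leq_trans (leq_pmulr _ N_ge1))// leq_addr.
have v0 := rnorm_ge0 v.
have mE : (k * N + N).-1 = (k * N + N.-1)%N by rewrite -{2}(prednK N_ge1) addnS.
set m := (k * N + N).-1.
have Cm : C m = C N.-1 by rewrite /m mE; exact: periodic_shift.
pose A := (alpha m)^-1%:C%C *: a m.
have close i w : rnorm (transfer a b z (k * N + i) w - limit_transfer l i w)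
    <= e * rnorm w.
  have := n1P (k * N + i)%N z w (big _ _ (leq_addr _ _)) zr'.
  rewrite (periodic_shift k i Rl_periodic) (periodic_shift k i T_periodic).
  by rewrite (periodic_shift k i Q_periodic).
have Lw i w : rnorm (limit_transfer l i w) <= Kl * rnorm w.
  rewrite (le_trans (opnorm_bound (limit_transfer_bounded l i) w))//.
  by rewrite ler_wpM2r ?rnorm_ge0//; exact: KlP.
have LK i w : rnorm (limit_transfer l i w) <= K * rnorm w.
  by rewrite (le_trans (Lw i w))// ler_wpM2r ?rnorm_ge0// lerDl.
have XK i w : rnorm (transfer a b z (k * N + i) w) <= K * rnorm w.
  rewrite -[transfer _ _ _ _ _](subrK (limit_transfer l i w)) addrC.
  rewrite (le_trans (ler_rnormD _ _))// mulrDl lerD// (le_trans (close _ _))//.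
  by rewrite ler_wpM2r ?rnorm_ge0.
set Xv := step z k v; set Yv := op_prod (limit_transfer l) N v.
have XvK : rnorm Xv <= K ^+ N * rnorm v by apply: op_prod_le.
have XY : rnorm (Xv - Yv) <= N%:R * K ^+ N * e * rnorm v.
  by apply: op_prod_close => //; exact: ltW.
have bA : bounded_op (A - C m) by apply: bounded_opB => //; exact: bounded_opZ.
have Ae : opnorm (A - C m) <= e.
  rewrite (le_trans (ler_norm _))// ltW// n2P// /m mE big// leq_addl//.
have diff : `|commform A Xv v - commform (C m) Yv v| <= e * G * rnorm v ^+ 2.
  have -> : commform A Xv v - commform (C m) Yv v =
      commform (A - C m) Xv v + commform (C m) (Xv - Yv) v.
    by rewrite commformBl commformBr//; ring.
  rewrite (le_trans (ler_normD _ _))//.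
  have -> : e * G * rnorm v ^+ 2 = 2 * e * (K ^+ N * rnorm v) * rnorm v
      + 2 * q * (N%:R * K ^+ N * e * rnorm v) * rnorm v by rewrite /G; ring.
  rewrite lerD// (le_trans (ler_commform _ _ _))// ler_wpM2r//.
    by rewrite ler_pM ?rnorm_ge0 ?mulr_ge0 ?opnorm_ge0// ler_wpM2l.
  by rewrite Cm ler_wpM2l// mulr_ge0.
have -> : commform (a m) Xv v = alpha m * commform A Xv v.
  by rewrite commformZl mulrA mulfV ?mul1r// gt_eqF.
rewrite [leRHS]mulrCA [c / 2 * _]mulrC -mulrA ler_wpM2l ?(ltW (alpha_gt0 _))//.
have := cP v; rewrite -/Yv -Cm.
have : `|s * commform A Xv v - s * commform (C m) Yv v| <= c / 2 * rnorm v ^+ 2.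
  rewrite -mulrBr normrM s1 mul1r (le_trans diff)// ler_wpM2r//.
  exact: sqr_ge0.
rewrite ler_norml => /andP[+ _].
move: (rnorm v ^+ 2) (s * commform A Xv v) (s * commform (C m) Yv v) => p x y.
lra.
Qed.

Lemma generalised_eigenvector_bounds (r : R) : 0 <= r ->
  exists2 B : R, 0 < B &
  forall n z u, (1 <= n)%N -> absc z <= r -> solves a b z u ->
    alpha n * rnorm (adjacent u n) ^+ 2 <= B * rnorm (adjacent u 1) ^+ 2 /\
    rnorm (adjacent u 1) ^+ 2 <= B * (alpha n * rnorm (adjacent u n) ^+ 2).
Proof.
have [M1 M10 IAP] := IA_uniform; have [M2 M20 IBP] := IB_uniform.
have [M3 M30 IRP] := IR_uniform; have [V1 V1P] := alpha_inv_sum.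
have [V2 V2P] := IB_variation; have [V3 V3P] := IR_variation.
have [s s1 sP] := turan_coercive.
have al0 n : 0 <= (alpha n)^-1 by rewrite invr_ge0 ltW.
apply: (@two_sided_bound _ _ a b N _ _ _ _ _ _ (M1 + M2 + M3)
  (`|V1| + `|V2| + `|V3|) _ _ _ _ _ _ _ s) => //.
- by rewrite !addr_gt0.
- move=> n x; rewrite (le_trans (IAP _ _))// ler_wpM2r ?rnorm_ge0// ler_wpM2r//.
  by rewrite -addrA lerDl addr_ge0// ltW.
- move=> n x; rewrite (le_trans (IBP _ _))// ler_wpM2r ?rnorm_ge0//.
  by rewrite addrAC lerDr addr_ge0// ltW.
- move=> n x; rewrite (le_trans (IRP _ _))// ler_wpM2r ?rnorm_ge0//.
  by rewrite lerDr addr_ge0// ltW.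
- move=> m; rewrite (le_trans (V1P m))// (le_trans (ler_norm _))//.
  by rewrite -addrA lerDl addr_ge0.
- move=> m; rewrite (le_trans (V2P m))// (le_trans (ler_norm _))//.
  by rewrite addrAC lerDr addr_ge0.
- move=> m; rewrite (le_trans (V3P m))// (le_trans (ler_norm _))//.
  by rewrite lerDr addr_ge0.
Qed.

End Hypotheses.

(** * Square-summable sequences and operator graphs *)

Section SquareSummable.
Variables (R : realType) (H : preHilbertType R).
Implicit Types u v : ell2 H.

Lemma ell2_dotE u v : dotp u v = csum (fun n => dotp (u n) (v n)).
Proof. by []. Qed.

Lemma ell2_mem (u : nat -> H) (V : R) :
  (forall m, \sum_(0 <= n < m) rnorm (u n) ^+ 2 <= V) -> u \in @ell2_pred R H.
Proof.
move=> uV; apply/asboolP; apply: nondecreasing_is_cvgn.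
  by apply/nondecreasing_series => n _ _; exact: sqr_ge0.
by exists V => _ [m _ <-]; exact: uV.
Qed.

Lemma ell2_cvg u : cvgn (series (fun n => rnorm (u n) ^+ 2)).
Proof. by have /asboolP := valP u. Qed.

Lemma ell2_rnorm_sqr u :
  rnorm u ^+ 2 = limn (series (fun n => rnorm (u n) ^+ 2)).
Proof.
rewrite -rdotpp /rdot ell2_dotE /csum /=; congr (limn (series _)).
by apply/funext => n; rewrite dotpp.
Qed.

Lemma ell2_partial_le u m : \sum_(0 <= n < m) rnorm (u n) ^+ 2 <= rnorm u ^+ 2.
Proof.
have nd : nondecreasing_seq (series (fun n => rnorm (u n) ^+ 2)).
  by apply/nondecreasing_series => n _ _; exact: sqr_ge0.
by rewrite ell2_rnorm_sqr; exact: (nondecreasing_cvgn_le nd (@ell2_cvg u) m).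
Qed.

Lemma ell2_rnorm_le u (V : R) :
  (forall m, \sum_(0 <= n < m) rnorm (u n) ^+ 2 <= V) -> rnorm u ^+ 2 <= V.
Proof.
move=> uV; rewrite ell2_rnorm_sqr; apply: limr_le; first exact: ell2_cvg.
exact: nearW.
Qed.

Lemma ell2_coord_le u n : rnorm (u n) <= rnorm u.
Proof.
rewrite -(@ler_pXn2r _ 2) ?nnegrE ?rnorm_ge0//.
rewrite (le_trans _ (ell2_partial_le u n.+1))// big_nat_recr//= lerDr.
by rewrite sumr_ge0// => i _; exact: sqr_ge0.
Qed.

Lemma ell2_csummable u v : csummable (fun n => dotp (u n) (v n)).
Proof.
apply: (csummable_le (b := (fun n => rnorm (u n) ^+ 2)
                         + (fun n => rnorm (v n) ^+ 2))); last first.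
  by apply: is_cvg_seriesD; exact: ell2_cvg.
move=> n; rewrite fctE (le_trans (absc_dot _ _))//.
have := sqr_ge0 (rnorm (u n) - rnorm (v n)).
have := mulr_ge0 (rnorm_ge0 (u n)) (rnorm_ge0 (v n)); nra.
Qed.

Lemma csum_partial (z : nat -> R[i]) (e : R) : csummable z -> 0 < e ->
  exists m0, forall m, (m0 <= m)%N -> absc (csum z - \sum_(0 <= n < m) z n) <= e.
Proof.
move=> [cr ci] e0; have e2 : 0 < e / 2 by rewrite divr_gt0.
have Resum m : complex.Re (\sum_(0 <= n < m) z n)
    = series (fun n => complex.Re (z n)) m.
  elim: m => [|m IHm]; first by rewrite /series/= !big_geq.
  by rewrite /series/= !big_nat_recr//= ReD IHm.
have Imsum m : complex.Im (\sum_(0 <= n < m) z n)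
    = series (fun n => complex.Im (z n)) m.
  elim: m => [|m IHm]; first by rewrite /series/= !big_geq.
  by rewrite /series/= !big_nat_recr//= ImD IHm.
move/cvgrPdist_lt: cr => /(_ _ e2)[m1 _ m1P].
move/cvgrPdist_lt: ci => /(_ _ e2)[m2 _ m2P].
exists (maxn m1 m2) => m; rewrite geq_max => /andP[/m1P/= h1 /m2P/= h2].
have -> : csum z - \sum_(0 <= n < m) z n =
    (limn (series (fun n => complex.Re (z n)))
      - series (fun n => complex.Re (z n)) m)%:C%C
    + 'i%C * (limn (series (fun n => complex.Im (z n)))
              - series (fun n => complex.Im (z n)) m)%:C%C.
  rewrite -Resum -Imsum /csum; case: (\sum_(_ <= _ < _) _) => x y.
  by apply/eqP; rewrite eq_complex/=; apply/andP; split; apply/eqP; ring.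
rewrite (le_trans (ler_abscD _ _))// [leRHS]splitr abscM.
have abscr (x : R) : absc x%:C%C = `|x|.
  by rewrite /absc normc_def/= expr0n addr0 sqrtr_sqr.
have -> : absc 'i%C = 1 :> R.
  by rewrite /absc normc_def/= expr0n add0r expr1n sqrtr1.
by rewrite mul1r !abscr lerD// ltW.
Qed.

Lemma ell2_dot_partial u v (e : R) : 0 < e -> exists m0, forall m, (m0 <= m)%N ->
  absc (dotp u v - \sum_(0 <= n < m) dotp (u n) (v n)) <= e.
Proof. by move=> e0; exact: csum_partial (ell2_csummable u v) e0. Qed.

Lemma ell2_dot_finite u v m : (forall n, (m <= n)%N -> u n = 0) ->
  dotp u v = \sum_(0 <= n < m) dotp (u n) (v n).
Proof.
move=> u0; apply/eqP; rewrite -subr_eq0; apply/eqP/absc0_eq0/eqP.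
rewrite eq_le absc_ge0 andbT; apply/ler_addgt0Pl => e e0; rewrite addr0.
have [m0 m0P] := ell2_dot_partial u v e0.
have := m0P (maxn m m0) (leq_maxr _ _).
rewrite (big_cat_nat (leq0n m) (leq_maxl m m0))/=.
have -> : \sum_(m <= n < maxn m m0) dotp (u n) (v n) = 0.
  rewrite big_nat_cond big1// => i /andP[/andP[mi _] _].
  by rewrite u0// dot0l.
by rewrite addr0.
Qed.

Lemma ell2_finite_mem (u : nat -> H) m : (forall n, (m <= n)%N -> u n = 0) ->
  u \in @ell2_pred R H.
Proof.
move=> u0; apply: (@ell2_mem _ (\sum_(0 <= n < m) rnorm (u n) ^+ 2)) => k.
have [km|/ltnW mk] := leqP k m.
  rewrite [leRHS](big_cat_nat (leq0n k) km)/= lerDl.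
  by rewrite sumr_ge0// => i _; exact: sqr_ge0.
rewrite (big_cat_nat (leq0n m) mk)/=.
have -> : \sum_(m <= n < k) rnorm (u n) ^+ 2 = 0.
  rewrite big_nat_cond big1// => i /andP[/andP[mi _] _].
  by rewrite u0// rnorm0 expr0n.
by rewrite addr0.
Qed.

Definition truncate_seq (u : nat -> H) m n : H := if (n < m)%N then u n else 0.

Let truncate_mem (u : nat -> H) m : truncate_seq u m \in @ell2_pred R H.
Proof.
by apply: (@ell2_finite_mem _ m) => n mn; rewrite /truncate_seq ltnNge mn.
Qed.

Definition truncate (u : nat -> H) m : ell2 H := Ell2 (truncate_mem u m).

Lemma truncateE (u : nat -> H) m n : truncate u m n = if (n < m)%N then u n else 0.
Proof. by []. Qed.

Lemma ell2_addE u v n : (u + v) n = u n + v n.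
Proof. by []. Qed.

Lemma ell2_oppE u n : (- u) n = - u n.
Proof. by []. Qed.

Lemma ell2_scaleE c u n : (c *: u) n = c *: u n.
Proof. by []. Qed.

Lemma truncate_close u (e : R) : 0 < e ->
  exists m0, forall m, (m0 <= m)%N -> rnorm (u - truncate u m) <= e.
Proof.
move=> e0; have e2 : 0 < e ^+ 2 by rewrite exprn_gt0.
have u0 n : 0 <= rnorm (u n) ^+ 2 by exact: sqr_ge0.
have [m0 m0P] := bounded_series_tail u0 (ell2_partial_le u) e2.
exists m0 => m m0m; rewrite -(@ler_pXn2r _ 2) ?nnegrE ?rnorm_ge0// ?(ltW e0)//.
apply: ell2_rnorm_le => k.
have tE n : rnorm ((u - truncate u m) n) ^+ 2 =
    if (n < m)%N then 0 else rnorm (u n) ^+ 2.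
  rewrite ell2_addE ell2_oppE truncateE; case: ifP => _; last by rewrite subr0.
  by rewrite subrr rnorm0 expr0n.
under eq_bigr => n _ do rewrite tE.
have [km|/ltnW mk] := leqP k m.
  rewrite big_nat_cond big1 ?ltW// => n /andP[/andP[_ nk] _].
  by rewrite (leq_trans nk km).
rewrite (big_cat_nat (leq0n m) mk)/=.
set s0 := \sum_(0 <= n < m) _; have -> : s0 = 0.
  by rewrite /s0 big_nat_cond big1// => n /andP[/andP[_ ->]].
rewrite add0r; apply: le_trans (m0P k).
rewrite [leRHS](big_cat_nat m0m mk)/= ler_wpDl ?sumr_ge0//.
by apply: ler_sum => n _; case: ifP.
Qed.

End SquareSummable.

Section MetricReformulations.
Variable R : realType.

Lemma rball_nbhs (V : normedModType R[i]) (x : V) (A : set V) :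
  nbhs x A <-> exists2 e : R, 0 < e & forall y, rnorm (x - y) < e -> A y.
Proof.
split=> [/nbhs_ballP[e e0 eA]|[e e0 eA]].
  have e0' : 0 < complex.Re e /\ e = (complex.Re e)%:C%C.
    by rewrite -ltcR RRe_real ?gtr0_real.
  exists (complex.Re e); first exact: e0'.1.
  move=> y xy; apply: eA; rewrite -ball_normE/= [ltRHS]e0'.2.
  by rewrite rnorm_lt.
apply/nbhs_ballP; exists e%:C%C; first by rewrite /= ltcR.
by move=> y; rewrite -ball_normE/= rnorm_lt; exact: eA.
Qed.

(** The product topology is the one of the maximum of the two norms. *)
Lemma closure_pairP (V : normedModType R[i]) (A : set (V * V)) p :
  closure A p <-> forall e : R, 0 < e ->
    exists2 q, A q & rnorm (p.1 - q.1) < e /\ rnorm (p.2 - q.2) < e.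
Proof.
split=> [Ap e e0|Ap B [[B1 B2]/= [/rball_nbhs[e1 e10 h1] /rball_nbhs[e2 e20 h2]] BB]].
  have [|q [Aq [/= q1 q2]]] := Ap ([set y | rnorm (p.1 - y) < e] `*`
      [set y | rnorm (p.2 - y) < e]); last by exists q.
  by exists ([set y | rnorm (p.1 - y) < e], [set y | rnorm (p.2 - y) < e]) => //=;
    split; apply/rball_nbhs; exists e.
have e0 : 0 < Num.min e1 e2 by rewrite lt_min e10.
have [q Aq [q1 q2]] := Ap _ e0; exists q; split=> //.
apply: BB; split; [apply: h1; apply: lt_le_trans q1 _|
  apply: h2; apply: lt_le_trans q2 _]; by rewrite ge_min lexx ?orbT.
Qed.

Lemma rlipschitz_continuous (V W : normedModType R[i]) (f : V -> W) (K : R) :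
  (forall x y, rnorm (f x - f y) <= K * rnorm (x - y)) -> continuous f.
Proof.
move=> fK x A /rball_nbhs[e e0 eA]; apply/rball_nbhs.
have K0 : 0 < `|K| + 1 by rewrite ltr_wpDl.
exists (e / (`|K| + 1)); first by rewrite divr_gt0.
move=> y; rewrite ltr_pdivlMr// => xy; apply: eA; apply: le_lt_trans xy.
rewrite (le_trans (fK x y))// mulrC ler_wpM2l ?rnorm_ge0//.
by rewrite (le_trans (ler_norm K))// lerDl.
Qed.

End MetricReformulations.

Section Graphs.
Variables (R : realType) (V : preHilbertType R).
Implicit Types (G : set (V * V)) (p q : V * V).

Lemma eq_of_absc_le (x y : R[i]) (K : R) :
  (forall e : R, 0 < e -> absc (x - y) <= K * e) -> x = y.
Proof.
move=> h; apply/eqP; rewrite -subr_eq0; apply/eqP/absc0_eq0/eqP.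
rewrite eq_le absc_ge0 andbT; apply/ler_addgt0Pl => e e0; rewrite addr0.
have K0 : 0 < `|K| + 1 by rewrite ltr_wpDl.
have e1 : 0 < e / (`|K| + 1) by rewrite divr_gt0.
rewrite (le_trans (h _ e1))// mulrCA ler_piMr ?(ltW e0)//.
by rewrite ler_pdivrMr// mul1r (le_trans (ler_norm K))// lerDl.
Qed.

(** Being in the adjoint is a closed condition on each tested pair. *)
Lemma adj_graph_closure G : adj_graph (closure G) = adj_graph G.
Proof.
apply/seteqP; split=> p Gp q Gq; first by apply: Gp; exact: subset_closure.
apply: (@eq_of_absc_le _ _ (rnorm p.1 + rnorm p.2)) => e e0.
have /closure_pairP/(_ e e0)[g Gg [g1 g2]] := Gq.
have -> : dotp q.2 p.1 - dotp q.1 p.2 = dotp (q.2 - g.2) p.1 - dotp (q.1 - g.1) p.2.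
  by rewrite !dotBl (Gp g Gg); ring.
rewrite (le_trans (ler_abscD _ _))// abscN mulrDl lerD//.
  by rewrite (le_trans (absc_dot _ _))// mulrC ler_wpM2l ?rnorm_ge0// ltW.
by rewrite (le_trans (absc_dot _ _))// mulrC ler_wpM2l ?rnorm_ge0// ltW.
Qed.

Lemma adj_graph_sym G p :
  adj_graph G p <-> forall q, G q -> dotp p.2 q.1 = dotp p.1 q.2.
Proof.
by split=> h q /h e; rewrite [LHS]dotC [RHS]dotC e.
Qed.

(** The relation tested by [adj_graph] is symmetric in its two pairs, so the
    closure can be taken in either of them. *)
Lemma closure_sub_adj G : G `<=` adj_graph G -> closure G `<=` adj_graph (closure G).
Proof.
move=> GG p Gp; rewrite adj_graph_closure; apply/adj_graph_sym => q Gq.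
by have := GG q Gq; rewrite -adj_graph_closure; apply.
Qed.

Lemma adj_graph_comb G c p q : adj_graph G p -> adj_graph G q ->
  adj_graph G (c *: p + q).
Proof.
by move=> Gp Gq g Gg /=; rewrite !dotDr !dotZr Gp// Gq.
Qed.

Lemma closure_comb G : (forall c p q, G p -> G q -> G (c *: p + q)) ->
  forall c p q, closure G p -> closure G q -> closure G (c *: p + q).
Proof.
move=> Gc c p q /closure_pairP Gp /closure_pairP Gq; apply/closure_pairP => e e0.
have c0 : 0 < absc c + 1 by rewrite ltr_wpDl ?absc_ge0.
have e1 : 0 < e / (absc c + 1) by rewrite divr_gt0.
have [p' Gp' [p1 p2]] := Gp _ e1; have [q' Gq' [q1 q2]] := Gq _ e1.
exists (c *: p' + q'); first exact: Gc.
have bound (x x' y y' : V) : rnorm (x - x') < e / (absc c + 1) ->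
    rnorm (y - y') < e / (absc c + 1) -> rnorm (c *: x + y - (c *: x' + y')) < e.
  move=> h1 h2.
  have -> : c *: x + y - (c *: x' + y') = c *: (x - x') + (y - y').
    by rewrite scalerBr opprD addrACA.
  rewrite (le_lt_trans (ler_rnormD _ _))// rnormZc.
  apply: (@le_lt_trans _ _ (absc c * (e / (absc c + 1)) + rnorm (y - y'))).
    by rewrite lerD2r ler_wpM2l ?absc_ge0// ltW.
  have eE : e - absc c * (e / (absc c + 1)) = e / (absc c + 1).
    by field; rewrite gt_eqF.
  by rewrite -ltrBrDl eE.
by split; apply: bound.
Qed.

End Graphs.

(** * The block Jacobi operator and its adjoint *)

Section JacobiOperator.
Variables (R : realType) (H : hilbertType R) (a b : nat -> H -> H).
Hypothesis a_bounded : forall n, bounded_op (a n).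
Hypothesis b_bounded : forall n, bounded_op (b n).
Hypothesis b_sa : forall n, self_adjoint_op (b n).
Implicit Types (u v w : nat -> H) (z c : R[i]).

Local Notation J := (jacobi a b).

Let aa_bounded n : bounded_op (adj (a n)).
Proof. exact: adj_bounded. Qed.

Lemma jacobi_comb c u v n :
  J (fun k => c *: u k + v k) n = c *: J u n + J v n.
Proof.
case: n => [|n] /=.
  rewrite !(opD (b_bounded _), opD (a_bounded _), opZ (b_bounded _), opZ (a_bounded _)).
  by vector_ring.
rewrite !(opD (b_bounded _), opD (a_bounded _), opD (aa_bounded _)).
rewrite !(opZ (b_bounded _), opZ (a_bounded _), opZ (aa_bounded _)).
by vector_ring.
Qed.

Definition wronskian u v n : R[i] :=
  dotp (a n (u n.+1)) (v n) - dotp (u n) (a n (v n.+1)).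

(** Summation by parts: the inner contributions cancel in pairs, and only the
    boundary term at the upper end remains. *)
Lemma green u v n :
  \sum_(0 <= k < n.+1) (dotp (J u k) (v k) - dotp (u k) (J v k))
    = wronskian u v n.
Proof.
have bb k x y : dotp (b k x) y = dotp x (b k y).
  by rewrite (adjP (b_bounded k)) b_sa.
have aE k x y : dotp (adj (a k) x) y = dotp x (a k y).
  exact: (has_adjC (adjP (a_bounded k))).
have aE' k x y : dotp x (adj (a k) y) = dotp (a k x) y.
  by rewrite (adjP (a_bounded k)).
elim: n => [|n IHn].
  by rewrite big_nat1 /= dotDl dotDr bb /wronskian; ring.
rewrite big_nat_recr//= IHn /wronskian !dotDl !dotDr bb.
by rewrite aE aE'; ring.
Qed.

Definition finite_graph : set (ell2 H * ell2 H) :=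
  [set p : ell2 H * ell2 H |
    (exists m, forall n, (m <= n)%N -> p.1 n = 0) /\
    forall n, p.2 n = J p.1 n].

Lemma jacobi_finite u m : (forall n, (m <= n)%N -> u n = 0) ->
  forall n, (m < n)%N -> J u n = 0.
Proof.
move=> u0 [//|n] mn /=; rewrite ltnS in mn.
rewrite (u0 n)// (u0 n.+1) ?(leqW mn)// (u0 n.+2) ?leqW ?(leqW mn)//.
by rewrite (op0 (aa_bounded _)) (op0 (a_bounded _)) (op0 (b_bounded _)) !addr0.
Qed.

Lemma finite_graph_exists u m : (forall n, (m <= n)%N -> u n = 0) ->
  exists2 p, finite_graph p & p.1 = u :> (nat -> H).
Proof.
move=> u0; pose p1 : ell2 H := Ell2 (ell2_finite_mem u0).
have Ju := @ell2_finite_mem _ _ (J u) m.+1 (jacobi_finite u0).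
pose p2 : ell2 H := Ell2 Ju.
by exists (p1, p2) => //; split; [exists m|].
Qed.

(** Pairing with the sequences supported at a single index shows that the
    adjoint is the maximal operator. *)
Lemma adj_finite_graph : adj_graph finite_graph =
  [set p : ell2 H * ell2 H | forall n, p.2 n = J p.1 n].
Proof.
apply/seteqP; split=> p /= Gp.
  move=> k; apply: dot_inj => x.
  pose u n : H := if n == k then x else 0.
  have u0 n : (k.+1 <= n)%N -> u n = 0.
    by move=> kn; rewrite /u gtn_eqF.
  have [q Gq qu] := finite_graph_exists u0.
  have Gpq := Gp q Gq.
  have q0 n : (k.+1 <= n)%N -> q.1 n = 0 by move=> kn; rewrite qu u0.
  have q2 n : (k.+2 <= n)%N -> q.2 n = 0.
    by move=> kn; rewrite Gq.2 (jacobi_finite q0).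
  rewrite (ell2_dot_finite _ q2) in Gpq.
  have q0' n : (k.+2 <= n)%N -> q.1 n = 0 by move=> /ltnW/q0.
  rewrite (ell2_dot_finite _ q0') in Gpq.
  have := green q.1 p.1 k.+1; rewrite /wronskian.
  rewrite (q0 k.+2)// (q0 k.+1)// (op0 (a_bounded _)) !dot0l subrr.
  rewrite big_split/= sumrN => /eqP; rewrite subr_eq0 => /eqP.
  under eq_bigr => i _ do rewrite -Gq.2.
  rewrite Gpq.
  have pick (f : nat -> H) : \sum_(0 <= n < k.+2) dotp (q.1 n) (f n) = dotp x (f k).
    rewrite big_nat_recr//= big_nat_recr//= (q0 k.+1)// dot0l addr0 qu {2}/u eqxx.
    rewrite big_nat_cond big1 ?add0r// => i /andP[/andP[_ ik] _].
    by rewrite /u ltn_eqF// dot0l.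
  by rewrite !pick.
move=> q [[m q0] q2].
have q0' n : (m.+1 <= n)%N -> q.1 n = 0 by move=> /ltnW/q0.
have q2' n : (m.+1 <= n)%N -> q.2 n = 0 by move=> mn; rewrite q2 (jacobi_finite q0).
rewrite (ell2_dot_finite _ q0') (ell2_dot_finite _ q2').
apply/eqP; rewrite -subr_eq0 -sumrB; apply/eqP.
under eq_bigr => i _ do rewrite q2 Gp.
rewrite green /wronskian (q0 m)// (q0 m.+1)// (op0 (a_bounded _)) !dot0l subrr//.
Qed.

Lemma jacobi_graph_closure : jacobi_graph a b = closure finite_graph.
Proof. by []. Qed.

Lemma adj_jacobi_graph : adj_graph (jacobi_graph a b) =
  [set p : ell2 H * ell2 H | forall n, p.2 n = J p.1 n].
Proof. by rewrite jacobi_graph_closure adj_graph_closure adj_finite_graph. Qed.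

Lemma finite_graph_symmetric : finite_graph `<=` adj_graph finite_graph.
Proof. by rewrite adj_finite_graph => p []. Qed.

Lemma finite_graph_comb c p q :
  finite_graph p -> finite_graph q -> finite_graph (c *: p + q).
Proof.
move=> [[m p0] p2] [[k q0] q2]; split=> [|n].
  exists (maxn m k) => n; rewrite geq_max => /andP[mn kn].
  by rewrite ell2_addE ell2_scaleE p0// q0// scaler0 addr0.
by rewrite ell2_addE ell2_scaleE p2 q2 -jacobi_comb.
Qed.

Lemma jacobi0 n : J (fun=> 0) n = 0.
Proof.
case: n => [|n] /=; rewrite ?(op0 (aa_bounded _)) (op0 (a_bounded _));
  by rewrite (op0 (b_bounded _)) !addr0.
Qed.

Lemma jacobi_graph_sub_adj : jacobi_graph a b `<=` adj_graph (jacobi_graph a b).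
Proof. exact: closure_sub_adj finite_graph_symmetric. Qed.

Lemma maximal_single_valued (w : ell2 H) :
  adj_graph (jacobi_graph a b) (0, w) -> w = 0.
Proof.
rewrite adj_jacobi_graph /= => w0; apply: val_inj; apply/funext => n.
by rewrite /= w0; exact: jacobi0.
Qed.

Lemma jacobi_graph_linear : linear_graph (jacobi_graph a b).
Proof.
split=> [|c p q|w].
- apply: subset_closure; split=> [|n /=]; first by exists 0%N.
  by rewrite [RHS]jacobi0.
- exact: (closure_comb finite_graph_comb).
- by move=> /jacobi_graph_sub_adj; exact: maximal_single_valued.
Qed.

Lemma jacobi_graph_dense : densely_defined (jacobi_graph a b).
Proof.
move=> O [x Ox] oO.
have /rball_nbhs[e e0 eO] : nbhs x O by exact: open_nbhs_nbhs.
have e2 : 0 < e / 2 by rewrite divr_gt0.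
have [m mP] := truncate_close x e2.
exists (truncate x m); split.
  apply: eO; apply: le_lt_trans (mP m (leqnn m)) _.
  by rewrite ltr_pdivrMr// ltr_pMr// ltr1n.
have t0 n : (m <= n)%N -> truncate x m n = 0.
  by move=> mn; rewrite truncateE ltnNge mn.
have [p Gp p1] := finite_graph_exists t0.
by exists p; [exact: subset_closure|apply: val_inj].
Qed.

Lemma jacobi_graph_symmetric : symmetric_graph (jacobi_graph a b).
Proof.
split; [exact: jacobi_graph_linear|exact: jacobi_graph_dense|].
exact: jacobi_graph_sub_adj.
Qed.

End JacobiOperator.

(** * Defect spaces and self-adjoint extensions *)

Section CompletelyIndeterminate.
Variables (R : realType) (H : hilbertType R) (a b : nat -> H -> H).
Hypothesis H_neq0 : exists x : H, x != 0.
Hypothesis a_bounded : forall n, bounded_op (a n).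
Hypothesis a_inv : forall n, boundedly_invertible (a n).
Hypothesis b_bounded : forall n, bounded_op (b n).
Hypothesis b_sa : forall n, self_adjoint_op (b n).
Hypothesis solutions_ell2 : forall z : R[i], exists2 B : R, 0 <= B &
  forall u, solves a b z u -> forall m,
    \sum_(0 <= n < m) rnorm (u n) ^+ 2 <= B * rnorm (adjacent u 1) ^+ 2.
Implicit Types (u v w : nat -> H) (x y : H) (z c : R[i]).

Local Notation J := (jacobi a b).
Local Notation A := (jacobi_graph a b).
Local Notation sol z x y := (forward_solution a b z ((x, y) : dsum H)).

Let ia_bounded n : bounded_op (invop (a n)).
Proof. by case: (invopP (a_inv n)). Qed.

Let iaK n : cancel (a n) (invop (a n)).
Proof. by case: (invopP (a_inv n)). Qed.

Let aiK n : cancel (invop (a n)) (a n).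
Proof. by case: (invopP (a_inv n)). Qed.

Lemma solution_mem z u : solves a b z u -> u \in @ell2_pred R H.
Proof.
by move=> uz; have [B _ BP] := solutions_ell2 z; apply: ell2_mem (BP u uz).
Qed.

Let sol_solves z x y : solves a b z (sol z x y).
Proof. exact: forward_solves. Qed.

Definition kernel_seq z x : nat -> H :=
  sol z x (invop (a 0%N) (z *: x - b 0%N x)).

Lemma kernel_seq_solves z x : solves a b z (kernel_seq z x).
Proof. exact: sol_solves. Qed.

Lemma kernel_seq0 z x : kernel_seq z x 0%N = x.
Proof. by []. Qed.

Lemma jacobi_kernel_seq z x n : J (kernel_seq z x) n = z *: kernel_seq z x n.
Proof.
case: n => [|n]; last exact: kernel_seq_solves.
by rewrite /= aiK; vector_ring.
Qed.

Definition kernel_map z x : ell2 H := Ell2 (solution_mem (kernel_seq_solves z x)).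

(** The equation at index [0] determines [u 1] from [u 0], since [a 0] is
    invertible. *)
Lemma kernel_seq_unique z u : (forall n, J u n = z *: u n) ->
  u = kernel_seq z (u 0%N).
Proof.
move=> Ju; apply: (solution_unique a_bounded a_inv _ (kernel_seq_solves z _)) => //.
by apply: (can_inj (@iaK 0%N)); rewrite /= aiK -Ju /=; vector_ring.
Qed.

Lemma kernel_map_linear z : linear (kernel_map z).
Proof.
move=> c x y; apply: val_inj; apply: esym.
pose u n := c *: kernel_seq z x n + kernel_seq z y n.
rewrite -[LHS]/u -[RHS]/(kernel_seq z (u 0%N)); apply: kernel_seq_unique => n.
by rewrite /u jacobi_comb// !jacobi_kernel_seq; vector_ring.
Qed.

Lemma kernel_map_bounded z :
  exists2 B : R, 0 <= B & forall x, rnorm (kernel_map z x) <= B * rnorm x.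
Proof.
have [B B0 BP] := solutions_ell2 z.
pose k := 1 + opnorm (invop (a 0%N)) * (absc z + opnorm (b 0%N)).
have k0 : 0 <= k.
  by rewrite addr_ge0// mulr_ge0 ?addr_ge0 ?opnorm_ge0 ?absc_ge0.
exists (Num.sqrt B * k) => [|x]; first by rewrite mulr_ge0 ?sqrtr_ge0.
rewrite -(@ler_pXn2r _ 2) ?nnegrE ?mulr_ge0 ?sqrtr_ge0 ?rnorm_ge0//.
apply: ell2_rnorm_le => m; rewrite (le_trans (BP _ (kernel_seq_solves z x) m))//.
rewrite -mulrA exprMn sqr_sqrtr// ler_wpM2l//.
rewrite ler_pXn2r ?nnegrE ?mulr_ge0 ?rnorm_ge0//.
rewrite (le_trans (dsum_rnorm_le _))// mulrDl mul1r lerD//=.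
rewrite (le_trans (opnorm_bound (ia_bounded _) _))// -mulrA.
rewrite ler_wpM2l ?opnorm_ge0// (le_trans (ler_rnormB _ _))// mulrDl.
by rewrite rnormZc lerD// opnorm_bound.
Qed.

Lemma kernel_map_in z x : adj_graph A (kernel_map z x, z *: kernel_map z x).
Proof.
by rewrite adj_jacobi_graph// => n /=; rewrite jacobi_kernel_seq.
Qed.

Lemma kernel_homeomorphic z : linearly_homeomorphic (ker_sub (adj_graph A) z) H.
Proof.
exists (kernel_map z), (fun v : ell2 H => v 0%N); split.
- exact: kernel_map_linear.
- have [B _ BP] := kernel_map_bounded z.
  apply: (@rlipschitz_continuous _ _ _ _ B) => x y.
  have -> : kernel_map z x - kernel_map z y = kernel_map z (x - y).
    have kl := kernel_map_linear z (-1) y x.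
    by rewrite !scaleN1r in kl; rewrite addrC -kl [- y + x]addrC.
  exact: BP.
- apply/seteqP; split=> [_ [x _ <-]|v]; first exact: kernel_map_in.
  rewrite /ker_sub/= adj_jacobi_graph//= => Jv; exists (v 0%N) => //.
  apply: val_inj => /=; apply/esym; apply: kernel_seq_unique => n.
  by rewrite -Jv.
- by move=> x.
- apply: continuous_subspaceT => v.
  apply: (@rlipschitz_continuous _ (ell2 H) H (fun v : ell2 H => v 0%N) 1) => u w.
  by rewrite mul1r -ell2_oppE -ell2_addE ell2_coord_le.
Qed.

(** A symmetric operator has no eigenvalue ['i], whereas the adjoint has one. *)
Lemma jacobi_graph_not_self_adjoint : ~ self_adjoint_graph A.
Proof.
move=> [_ _ AA]; have [x /eqP] := H_neq0; apply.
have := kernel_map_in 'i%C x; rewrite {1}AA => Av.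
have := kernel_map_in 'i%C x => /(_ _ Av) /=.
rewrite dotZl dotZr => /eqP; rewrite -subr_eq0 -mulrBl mulf_eq0.
have -> : ('i%C - 'i%C^* : R[i]) == 0 = false.
  apply/negbTE; rewrite eq_complex/= negb_and; apply/orP; right.
  by rewrite subr_eq0 -subr_eq0 opprK gt_eqF// addr_gt0.
rewrite /= dotpp => /eqP v0.
have {}v0 : rnorm (kernel_map 'i%C x) = 0.
  by apply/eqP; rewrite -sqrf_eq0; apply/eqP; apply: (@complexI R); rewrite v0.
by rewrite -(kernel_seq0 'i%C x) -[LHS]/(kernel_map 'i%C x 0%N) (rnorm0_eq0 v0).
Qed.

(** When the range of [A] is closed this is the sum of [A] and of the zero
    operator on the kernel of the adjoint, that is, the analogue of the
    Krein-von Neumann extension. *)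
Definition kernel_extension : set (ell2 H * ell2 H) :=
  [set p | adj_graph A p /\ forall k, adj_graph A (k, 0) -> dotp k p.2 = 0].

(** The Wronskian at [n] only sees the values at [n] and [n.+1], where any
    sequence can be replaced by a solution. *)
Let interpolate u n : exists2 w, solves a b 0 w & w n = u n /\ w n.+1 = u n.+1.
Proof.
have [w w0 wu] := solution_through b a_bounded a_inv 0 n ((u n, u n.+1) : dsum H).
by exists w => //; move: wu; rewrite /adjacent /= => -[-> ->].
Qed.

Let wronskian_eq u u' v v' n : u n = u' n -> u n.+1 = u' n.+1 ->
  v n = v' n -> v n.+1 = v' n.+1 -> wronskian a u v n = wronskian a u' v' n.
Proof. by rewrite /wronskian => -> -> -> ->. Qed.

Let wronskian_solutions u v n : solves a b 0 u -> solves a b 0 v ->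
  wronskian a u v n = dotp (J u 0%N) (v 0%N) - dotp (u 0%N) (J v 0%N).
Proof.
move=> u0 v0; rewrite -(green a_bounded b_bounded b_sa) big_nat_recl//.
rewrite big_nat_cond big1 ?addr0// => i _.
by rewrite (u0 i.+1)// (v0 i.+1)// !scale0r dot0l dot0r subrr.
Qed.

Let dual_seq x : nat -> H := sol 0 0 (invop (a 0%N) x).

Let dual_map x : ell2 H := Ell2 (solution_mem (sol_solves 0 0 (invop (a 0%N) x))).

Let dual_map_bounded :
  exists2 B : R, 0 <= B & forall x, rnorm (dual_map x) <= B * rnorm x.
Proof.
have [B B0 BP] := solutions_ell2 0; pose k := opnorm (invop (a 0%N)).
have k0 : 0 <= k by exact: opnorm_ge0.
exists (Num.sqrt B * k) => [|x]; first by rewrite mulr_ge0 ?sqrtr_ge0.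
rewrite -(@ler_pXn2r _ 2) ?nnegrE ?mulr_ge0 ?sqrtr_ge0 ?rnorm_ge0//.
apply: ell2_rnorm_le => m; rewrite (le_trans (BP _ (sol_solves 0 0 _) m))//.
rewrite -mulrA exprMn sqr_sqrtr// ler_wpM2l//.
rewrite ler_pXn2r ?nnegrE ?mulr_ge0 ?rnorm_ge0//.
rewrite (le_trans (dsum_rnorm_le _))//= rnorm0 add0r.
exact: opnorm_bound.
Qed.

Let jacobi_dual x n : J (dual_seq x) n = if n == 0%N then x else 0.
Proof.
case: n => [|n]; last by rewrite (sol_solves 0 _ _ (ltn0Sn n)) scale0r.
by rewrite /= (op0 (b_bounded _)) add0r aiK.
Qed.

(** The initial data of an interpolating solution [w] are recovered from its
    constant Wronskians with the solutions that satisfy the boundary condition at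
    [0], which give [J w 0], and with those that vanish at [0], which give [w 0].
    Up to sign, the former Wronskians are tails of the series of an inner product
    that vanishes on the extension. *)
Let extension_data (p : ell2 H * ell2 H) : kernel_extension p ->
  exists2 K : R, 0 <= K & forall e : R, 0 < e -> exists m0, forall m w,
    (m0 <= m)%N -> solves a b 0 w -> w m = p.1 m -> w m.+1 = p.1 m.+1 ->
    rnorm (J w 0%N) <= e /\ rnorm (w 0%N) <= K.
Proof.
move=> [pA pker]; rewrite adj_jacobi_graph//= in pA.
have [B B0 BP] := kernel_map_bounded 0; have [D D0 DP] := dual_map_bounded.
exists (D * rnorm p.2 + rnorm p.1).
  by rewrite addr_ge0 ?mulr_ge0 ?rnorm_ge0.
move=> e e0; have B1 : 0 < B + 1 by rewrite ltr_wpDl.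
have e1 : 0 < e / (B + 1) by rewrite divr_gt0.
have [m0 m0P] := truncate_close p.2 e1; exists m0 => m w mm w0 wm wm1.
have test (k : nat -> H) : solves a b 0 k ->
    dotp (J w 0%N) (k 0%N) - dotp (w 0%N) (J k 0%N)
    = \sum_(0 <= n < m.+1) (dotp (p.2 n) (k n) - dotp (p.1 n) (J k n)).
  move=> k0; rewrite -(wronskian_solutions m w0 k0).
  rewrite (@wronskian_eq w p.1 k k m)// -(green a_bounded b_bounded b_sa).
  by apply: eq_bigr => i _; rewrite pA.
have trunc_dot (v : ell2 H) : \sum_(0 <= n < m.+1) dotp (p.2 n) (v n)
    = dotp (truncate p.2 m.+1) v.
  rewrite (@ell2_dot_finite _ _ _ _ m.+1).
    apply: eq_big_nat => i /andP[_ im].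
    by rewrite truncateE im.
  by move=> n mn; rewrite truncateE ltnNge mn.
split.
  set s := J w 0%N.
  have := test _ (kernel_seq_solves 0 s).
  rewrite jacobi_kernel_seq scale0r dot0r subr0 kernel_seq0.
  under eq_bigr => n _ do rewrite jacobi_kernel_seq scale0r dot0r subr0.
  rewrite (trunc_dot (kernel_map 0 s)).
  have kk : dotp p.2 (kernel_map 0 s) = 0.
    rewrite dotC pker ?conjC0//.
    by have := kernel_map_in 0 s; rewrite scale0r.
  have [s0|s0] := eqVneq (rnorm s) 0; first by rewrite s0 ltW.
  have sp : 0 < rnorm s by rewrite lt_def s0 rnorm_ge0.
  have -> : dotp (truncate p.2 m.+1) (kernel_map 0 s)
      = dotp (truncate p.2 m.+1 - p.2) (kernel_map 0 s) by rewrite dotBl kk subr0.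
  rewrite dotpp => ss_dot.
  have ss : rnorm s ^+ 2
      = complex.Re (dotp (truncate p.2 m.+1 - p.2) (kernel_map 0 s)).
    by rewrite -ss_dot.
  rewrite -(ler_pM2r sp) -expr2 ss (le_trans (Re_le_absc _))//.
  rewrite (le_trans (absc_dot _ _))// rnormBC.
  have mm1 : (m0 <= m.+1)%N by exact: leqW.
  rewrite (le_trans (ler_pM _ _ (m0P _ mm1) (BP s))) ?rnorm_ge0//.
  rewrite mulrA ler_wpM2r ?rnorm_ge0// mulrAC -mulrA ger_pMr//.
  by rewrite ler_pdivrMr// mul1r lerDl.
set y := w 0%N.
have := test _ (sol_solves 0 0 (invop (a 0%N) y)).
rewrite -/(dual_seq y) jacobi_dual /= dot0r sub0r sumrB.
rewrite (trunc_dot (dual_map y)).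
have -> : \sum_(0 <= n < m.+1) dotp (p.1 n) (J (dual_seq y) n) = dotp (p.1 0%N) y.
  under eq_bigr => i _ do rewrite jacobi_dual.
  by rewrite big_nat_recl//= big1 ?addr0// => i _; rewrite dot0r.
have [y0|y0] := eqVneq (rnorm y) 0.
  by rewrite y0 addr_ge0 ?mulr_ge0 ?rnorm_ge0.
have yp : 0 < rnorm y by rewrite lt_def y0 rnorm_ge0.
move=> /(congr1 (@absc R)); rewrite abscN dotpp absc_real ?sqr_ge0// => ss.
rewrite -(ler_pM2r yp) -expr2 ss (le_trans (ler_abscD _ _))// abscN mulrDl lerD//.
  have t2 : rnorm (truncate p.2 m.+1) <= rnorm p.2.
    rewrite -(@ler_pXn2r _ 2) ?nnegrE ?rnorm_ge0//; apply: ell2_rnorm_le => k.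
    rewrite (le_trans _ (ell2_partial_le p.2 k))//; apply: ler_sum => i _.
    by rewrite truncateE; case: ifP => // _; rewrite rnorm0 expr0n sqr_ge0.
  rewrite (le_trans (absc_dot _ _))// [D * _]mulrC -mulrA.
  by rewrite ler_pM ?rnorm_ge0.
by rewrite (le_trans (absc_dot _ _))// ler_wpM2r ?rnorm_ge0// ell2_coord_le.
Qed.

(** The Wronskian of two elements at [n] is that of the interpolating solutions,
    which is constant and equal to [<s, y'> - <y, s'>] in terms of their initial
    data. Orthogonality to the kernel makes [s] and [s'] tend to zero. *)
Lemma kernel_extension_symmetric :
  kernel_extension `<=` adj_graph kernel_extension.
Proof.
move=> p Bp q Bq.
have [Kp Kp0 pP] := extension_data Bp; have [Kq Kq0 qP] := extension_data Bq.
apply: (@eq_of_absc_le _ _ _ (Kp + Kq + 2)) => e e0.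
have [mp mpP] := pP e e0; have [mq mqP] := qP e e0.
have [m1 m1P] := ell2_dot_partial q.2 p.1 e0.
have [m2 m2P] := ell2_dot_partial q.1 p.2 e0.
pose m := (mp + mq + m1 + m2)%N.
have [wp wp0 [wpm wpm1]] := interpolate p.1 m.
have [wq wq0 [wqm wqm1]] := interpolate q.1 m.
have mpm : (mp <= m)%N by rewrite /m -!addnA leq_addr.
have mqm : (mq <= m)%N by rewrite /m -!addnA addnCA leq_addr.
have m1m : (m1 <= m.+1)%N by rewrite leqW// /m addnAC leq_addl.
have m2m : (m2 <= m.+1)%N by rewrite leqW// /m leq_addl.
have [sp yp] := mpP m wp mpm wp0 wpm wpm1.
have [sq yq] := mqP m wq mqm wq0 wqm wqm1.
have h1 := m1P _ m1m; have h2 := m2P _ m2m.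
have pA := Bp.1; have qA := Bq.1; rewrite adj_jacobi_graph//= in pA qA.
have W : \sum_(0 <= n < m.+1) dotp (q.2 n) (p.1 n)
    - \sum_(0 <= n < m.+1) dotp (q.1 n) (p.2 n)
    = dotp (J wq 0%N) (wp 0%N) - dotp (wq 0%N) (J wp 0%N).
  rewrite -(wronskian_solutions m wq0 wp0).
  rewrite (@wronskian_eq wq q.1 wp p.1 m)// -(green a_bounded b_bounded b_sa).
  by rewrite -sumrB; apply: eq_bigr => i _; rewrite pA qA.
have -> : dotp q.2 p.1 - dotp q.1 p.2 =
    (dotp q.2 p.1 - \sum_(0 <= n < m.+1) dotp (q.2 n) (p.1 n))
    - (dotp q.1 p.2 - \sum_(0 <= n < m.+1) dotp (q.1 n) (p.2 n))
    + (dotp (J wq 0%N) (wp 0%N) - dotp (wq 0%N) (J wp 0%N)).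
  by rewrite -W; ring.
rewrite (le_trans (ler_abscD _ _))//.
have -> : (Kp + Kq + 2) * e = (e + e) + (e * Kp + Kq * e) by ring.
rewrite lerD// (le_trans (ler_abscD _ _))// abscN lerD//.
  by rewrite (le_trans (absc_dot _ _))// ler_pM ?rnorm_ge0.
by rewrite (le_trans (absc_dot _ _))// ler_pM ?rnorm_ge0.
Qed.

Lemma jacobi_graph_sub_extension : A `<=` kernel_extension.
Proof.
move=> p Ap; split=> [|k Ak]; first exact: jacobi_graph_sub_adj.
have pk : dotp p.2 k = 0 by rewrite (Ak p Ap) dot0r.
by rewrite dotC pk conjC0.
Qed.

(** Testing with [A] shows that the adjoint of the extension lies in the adjoint
    of [A]; testing with the pairs [(k, 0)], for [k] in the kernel of the adjoint
    of [A], shows the orthogonality. *)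
Lemma adj_kernel_extension : adj_graph kernel_extension = kernel_extension.
Proof.
apply/seteqP; split=> [p Bp|]; last exact: kernel_extension_symmetric.
split=> [q Aq|k Ak]; first by apply: Bp; exact: jacobi_graph_sub_extension.
have Bk : kernel_extension (k, 0) by split=> // k' _; rewrite dot0r.
by have := Bp _ Bk; rewrite /= dot0l.
Qed.

Lemma kernel_extension_self_adjoint : self_adjoint_graph kernel_extension.
Proof.
split; last exact: adj_kernel_extension.
- split=> [|c p q [Ap kp] [Aq kq]|w [Aw _]].
  + have A0 : A (0, 0) by have [] := jacobi_graph_linear a_bounded b_bounded b_sa.
    exact: jacobi_graph_sub_extension.
  + split=> [|k Ak /=]; first exact: adj_graph_comb.
    by rewrite dotDr dotZr kp// kq// mulr0 addr0.
  + exact: (maximal_single_valued a_bounded b_bounded b_sa Aw).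
- move=> O O0 oO.
  have dA : densely_defined A by exact: jacobi_graph_dense.
  have [x [Ox [p Ap px]]] := dA O O0 oO.
  by exists x; split=> //; exists p => //; exact: jacobi_graph_sub_extension.
Qed.

End CompletelyIndeterminate.

(** * The completely indeterminate case *)

Lemma compact_absc_bounded (R : realType) (K : set R[i]) :
  compact (K : set R[i]^o) ->
  exists2 r : R, 0 <= r & forall z, K z -> absc z <= r.
Proof.
move=> cK; pose f : R[i]^o -> R^o := @absc R.
have cf : continuous f.
  move=> z A /nbhs_ballP[e e0 eA]; apply/(@rball_nbhs R R[i]^o).
  exists e => // w zw; apply: eA; rewrite -ball_normE/=.
  apply: le_lt_trans zw; rewrite ler_norml.
  have := ler_abscD (z - w) w; have := ler_abscD (w - z) z.
  rewrite !subrK -(abscN (w - z)) opprB /f -[rnorm _]/(absc (z - w)) => h1 h2.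
  by apply/andP; split; lra.
have /compact_bounded[M [_ MP]] :=
  continuous_compact (continuous_subspaceT cf) cK.
exists (`|M| + 1) => [|z Kz]; first by rewrite addr_ge0.
have M1 : M < `|M| + 1 by rewrite (le_lt_trans (ler_norm _))// ltrDl.
by have /= := MP _ M1 _ (ex_intro2 _ _ z Kz erefl); rewrite ger0_norm ?absc_ge0.
Qed.

Theorem theorem3 (R : realType) (H : hilbertType R) (a b : nat -> H -> H)
    (N : nat) (T Q Rl C : nat -> H -> H)
  (H_neq0 : exists x : H, x != 0)
  (a_bounded : forall n, bounded_op (a n))
  (a_inv : forall n, boundedly_invertible (a n))
  (b_bounded : forall n, bounded_op (b n))
  (b_sa : forall n, self_adjoint_op (b n))
  (N_ge1 : (1 <= N)%N)
  (variation_lty :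
    (op_variation N 0 (fun n => invop (a n)) +
     op_variation N 0 (fun n => invop (a n) \o b n) +
     op_variation N 1 (fun n => invop (a n) \o adj (a n.-1)) < +oo)%E)
  (T_bounded : forall n, bounded_op (T n))
  (Q_bounded : forall n, bounded_op (Q n))
  (Rl_bounded : forall n, bounded_op (Rl n))
  (C_bounded : forall n, bounded_op (C n))
  (T_periodic : forall n, T (n + N)%N = T n)
  (Q_periodic : forall n, Q (n + N)%N = Q n)
  (Rl_periodic : forall n, Rl (n + N)%N = Rl n)
  (C_periodic : forall n, C (n + N)%N = C n)
  (C_inv : forall n, boundedly_invertible (C n))
  (lim_T : opnorm (invop (a n) - T n) @[n --> \oo] --> (0 : R))
  (lim_Q : opnorm (invop (a n) \o b n - Q n) @[n --> \oo] --> (0 : R))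
  (lim_Rl : opnorm (invop (a n) \o adj (a n.-1) - Rl n) @[n --> \oo] --> (0 : R))
  (lim_C : opnorm (((opnorm (a n))^-1)%:C%C *: a n - C n) @[n --> \oo]
             --> (0 : R))
  (Lambda_neq0 : Lambda N T Q Rl C !=set0)
  (not_carleman : ~ carleman a) :
  [/\ forall K : set R[i], compact (K : set R[i]^o) ->
        exists c1 c2 : R, [/\ 0 < c1, 0 < c2 &
          forall (z : R[i]) (u : nat -> H) (n : nat),
            K z -> generalised_eigenvector a b z u -> (1 <= n)%N ->
            c1 * (rnorm (u 0%N) ^+ 2 + rnorm (u 1%N) ^+ 2)
              <= opnorm (a n) * (rnorm (u n.-1) ^+ 2 + rnorm (u n) ^+ 2)
              <= c2 * (rnorm (u 0%N) ^+ 2 + rnorm (u 1%N) ^+ 2)],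
      forall z : R[i],
        linearly_homeomorphic (ker_sub (adj_graph (jacobi_graph a b)) z) H,
      symmetric_graph (jacobi_graph a b),
      ~ self_adjoint_graph (jacobi_graph a b) &
      exists B : set (ell2 H * ell2 H),
        self_adjoint_graph B /\ jacobi_graph a b `<=` B].
Proof.
have bounds := @generalised_eigenvector_bounds R H a b N T Q Rl C H_neq0 a_bounded
  a_inv b_bounded b_sa N_ge1 variation_lty T_bounded Q_bounded Rl_bounded C_bounded
  T_periodic Q_periodic Rl_periodic C_periodic C_inv lim_T lim_Q lim_Rl lim_C
  Lambda_neq0 not_carleman.
have alpha_gt0 n : 0 < opnorm (a n) by exact: opnorm_invertible_gt0.
have solutions_ell2 (z : R[i]) : exists2 B : R, 0 <= B & forall u,
    solves a b z u -> forall m,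
    \sum_(0 <= n < m) rnorm (u n) ^+ 2 <= B * rnorm (adjacent u 1) ^+ 2.
  have [B B0 BP] := bounds _ (absc_ge0 z).
  have [V VP] := alpha_inv_sum H_neq0 a_bounded a_inv not_carleman.
  have aV0 n : 0 <= (opnorm (a n))^-1 by rewrite invr_ge0 ltW.
  have V0 : 0 <= V by apply: le_trans (VP 0%N); rewrite big_geq.
  exists (1 + B * V) => [|u uz m]; first by rewrite addr_ge0// mulr_ge0// ltW.
  case: m => [|m].
    rewrite big_geq// mulr_ge0 ?sqr_ge0// addr_ge0// mulr_ge0//.
    exact: ltW.
  rewrite big_nat_recl// mulrDl mul1r lerD//.
    rewrite ler_pXn2r ?nnegrE ?rnorm_ge0//.
    exact: (dsum_rnorm_fst (adjacent u 1)).
  apply: (@le_trans _ _ (\sum_(0 <= n < m)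
      (opnorm (a n.+1))^-1 * (B * rnorm (adjacent u 1) ^+ 2))).
    apply: ler_sum => n _; have [h _] := BP n.+1 z u isT (lexx _) uz.
    rewrite mulrC ler_pdivlMr// mulrC (le_trans _ h)// ler_wpM2l ?(ltW (alpha_gt0 _))//.
    rewrite ler_pXn2r ?nnegrE ?rnorm_ge0//.
    exact: (dsum_rnorm_snd (adjacent u n.+1)).
  rewrite -mulr_suml mulrC mulrAC ler_wpM2r ?sqr_ge0// ler_wpM2l ?(ltW B0)//.
  by rewrite (le_trans _ (VP m.+1))// [leRHS]big_nat_recl// lerDr.
split.
- move=> K /compact_absc_bounded[r r0 Kr]; have [B B0 BP] := bounds r r0.
  exists B^-1, B; split=> [||z u n Kz [_ uz] n1]; rewrite ?invr_gt0//.
  have [h1 h2] := BP n z u n1 (Kr _ Kz) uz.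
  move: h1 h2; rewrite !dsum_rnorm_sqr /= => h1 h2.
  by rewrite h1 andbT mulrC ler_pdivrMr// mulrC.
- by move=> z; exact: kernel_homeomorphic.
- exact: jacobi_graph_symmetric.
- exact: jacobi_graph_not_self_adjoint.
- exists (kernel_extension a b); split.
    exact: kernel_extension_self_adjoint.
  exact: jacobi_graph_sub_extension.
Qed.
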